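(* Let $R$ be a noetherian commutative ring and let $f:\mathbb{P}^N_R\to\mathbb{P}^N_R$ be a morphism of degree at least $2$. Then the functor $\mathrm{Aut}_f$ is represented by a closed finite $R$-subgroup scheme $\mathrm{Aut}(f)\subset\mathrm{PGL}_{N+1}$.
   Context: A morphism $f:\mathbb{P}^N_R\to\mathbb{P}^N_R$ of degree $d$ is given by homogeneous polynomials $f_0,\dots,f_N\in R[x_0,\dots,x_N]$ of degree $d$ whose Macaulay resultant is a unit in $R$. For an $R$-algebra $S$, $\mathrm{PGL}_{N+1}(S)$ is identified with the automorphism group of $\mathbb{P}^N_S$, and for $\alpha\in\mathrm{PGL}_{N+1}(S)$ one sets $f^\alpha=\alpha\circ f\circ\alpha^{-1}$. The functor $\mathrm{Aut}_f$ from commutative $R$-algebras to groups is $S\mapsto\{\alpha\in\mathrm{PGL}_{N+1}(S): f^\alpha=f\}$, acting on $R$-algebra morphisms by base extension. *)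

(* Defs.v *)
From HB Require Import structures.
From mathcomp Require Import all_boot all_order all_algebra.
From mathcomp Require Import mpoly.

Set Implicit Arguments.
Unset Strict Implicit.
Unset Printing Implicit Defensive.

Import GRing.Theory.
Local Open Scope ring_scope.

(* Rings are possibly zero ([comPzRingType]). An algebra over R is a ring S    *)
(* with a structure morphism phi : {rmorphism R -> S}. Subsets of modules are  *)
(* Prop-valued predicates, compared extensionally by [same_set].               *)

Definition same_set (V : Type) (L L' : V -> Prop) : Prop :=
  forall v, L v <-> L' v.

Definition submodule (S : comPzRingType) (V : lmodType S) (L : V -> Prop) :=
  L 0 /\ forall (a : S) (u v : V), L u -> L v -> L (a *: u + v).

Definition modspan (S : comPzRingType) (V : lmodType S) (P : V -> Prop) : V -> Prop :=
  fun v => exists (r : nat) (a : 'I_r -> S) (w : 'I_r -> V),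
    (forall k, P (w k)) /\ v = \sum_(k < r) a k *: w k.

Definition is_ideal (S : comPzRingType) (J : S -> Prop) : Prop :=
  @submodule S S^o J.

Definition noetherian (R : comPzRingType) : Prop :=
  forall I : R -> Prop, is_ideal I ->
    exists (r : nat) (g : 'I_r -> R),
      forall x, I x <-> exists a : 'I_r -> R, x = \sum_(k < r) a k * g k.

Definition module_finite (R B : comPzRingType) (iota : {rmorphism R -> B}) :=
  exists (r : nat) (b : 'I_r -> B),
    forall x : B, exists a : 'I_r -> R, x = \sum_(k < r) iota (a k) * b k.

(* Homogeneous forms of degree d in n variables, as families of coefficients   *)
(* indexed by the monomials of degree d ({mpoly _} would exclude zero rings).  *)

Definition monomial (n d : nat) := {m : 'X_{1..n < d.+1} | mdeg m == d}.

Definition hform (R : comPzRingType) (n d : nat) := monomial n d -> R.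

Definition hform_eval (R T : comPzRingType) (phi : {rmorphism R -> T})
    (n d : nat) (F : hform R n d) (x : 'cV[T]_n) : T :=
  \sum_(m : monomial n d) phi (F m) * \prod_(j < n) x j 0 ^+ (val m : 'X_{1..n}) j.

Definition hform_Xpow (R : comPzRingType) (n d : nat) (i : 'I_n) : hform R n d :=
  fun m => if (val m : 'X_{1..n}) i == d then 1 else 0.

(* The Macaulay resultant of n forms of degree d in n variables, as an integer *)
(* polynomial in the coefficients u_(i,m) of n generic forms. It is the unique *)
(* irreducible polynomial over the integers which vanishes exactly at the      *)
(* systems with a nontrivial common zero over an algebraically closed field    *)
(* and takes the value 1 at (x_0^d, ..., x_(n-1)^d).                           *)

Definition coef_index (n d : nat) : finType := ('I_n * monomial n d)%type.

Definition coef_poly (n d : nat) := {mpoly int[#|coef_index n d|]}.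

Definition coef_eval (R : comPzRingType) (n d : nat) (P : coef_poly n d)
    (F : 'I_n -> hform R n d) : R :=
  \sum_(m <- msupp P)
    (P@_m)%:~R * \prod_(k < #|coef_index n d|)
                    F (enum_val k).1 (enum_val k).2 ^+ m k.

Definition macaulay_resultant (n d : nat) (Res : coef_poly n d) : Prop :=
  [/\ Res \isn't a GRing.unit /\
        (forall p q : coef_poly n d, Res = p * q ->
           p \is a GRing.unit \/ q \is a GRing.unit),
      forall (K : closedFieldType) (F : 'I_n -> hform K n d),
        coef_eval Res F = 0 <->
        exists2 x : 'cV[K]_n, x != 0 &
          forall i, hform_eval (idfun : {rmorphism K -> K}) (F i) x = 0 &
      coef_eval Res (fun i : 'I_n => @hform_Xpow int n d i) = 1].

Definition is_proj_morphism (R : comPzRingType) (N d : nat)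
    (f : 'I_N.+1 -> hform R N.+1 d) : Prop :=
  exists2 Res : coef_poly N.+1 d, macaulay_resultant Res &
    exists b : R, coef_eval Res f * b = 1.

(* [loc_gen s L v]: the localization of L at s is generated by v.              *)
Definition loc_gen (S : comPzRingType) (V : lmodType S)
    (s : S) (L : V -> Prop) (v : V) : Prop :=
  L v /\ forall w, L w -> exists (e : nat) (a : S), s ^+ e *: w = a *: v.

(* P^(n-1)(T): the submodules of T^n which, over the members D(s_k) of some    *)
(* finite cover of Spec T by basic opens, are generated by a vector whose      *)
(* coordinates generate the unit ideal; i.e. the direct summands of rank one.  *)
Definition proj_point (T : comPzRingType) (n : nat) (L : 'cV[T]_n -> Prop) :=
  submodule L /\
  exists (r : nat) (s c : 'I_r -> T) (v : 'I_r -> 'cV[T]_n),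
    \sum_(k < r) c k * s k = 1 /\
    forall k, loc_gen (s k) L (v k) /\
      exists (e : nat) (a : 'I_n -> T), \sum_(j < n) a j * v k j 0 = s k ^+ e.

(* PGL_n(S), as the open det <> 0 in the projective space of n x n matrices:   *)
(* the submodules of M_n(S) generated, over the D(s_k) as above, by a matrix   *)
(* whose determinant is invertible in S[1/s_k]. The class of g in GL_n(S) is   *)
(* the line S g; for S with nontrivial Picard group there are others.          *)
Definition pgl_point (S : comPzRingType) (n : nat) (L : 'M[S]_n -> Prop) :=
  submodule L /\
  exists (r : nat) (s c : 'I_r -> S) (g : 'I_r -> 'M[S]_n),
    \sum_(k < r) c k * s k = 1 /\
    forall k, loc_gen (s k) L (g k) /\
      exists (e : nat) (a : S), a * \det (g k) = s k ^+ e.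

Definition pgl_base (S T : comPzRingType) (n : nat) (h : {rmorphism S -> T})
    (L : 'M[S]_n -> Prop) : 'M[T]_n -> Prop :=
  modspan (fun M' => exists2 M, L M & M' = map_mx h M).

Definition pgl_one (S : comPzRingType) (n : nat) : 'M[S]_n -> Prop :=
  fun M => exists a : S, M = a%:M.

Definition pgl_mul (S : comPzRingType) (n : nat) (L L' : 'M[S]_n -> Prop) :
    'M[S]_n -> Prop :=
  modspan (fun M => exists g g' : 'M[S]_n, [/\ L g, L' g' & M = g *m g']).

(* Where L is generated by an invertible g, this is generated by g^-1.         *)
Definition pgl_inv (S : comPzRingType) (n : nat) (L : 'M[S]_n -> Prop) :
    'M[S]_n -> Prop :=
  fun M => forall g, L g -> pgl_one (M *m g).

Definition pgl_act (T : comPzRingType) (n : nat) (A : 'M[T]_n -> Prop)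
    (L : 'cV[T]_n -> Prop) : 'cV[T]_n -> Prop :=
  modspan (fun w => exists g v, [/\ A g, L v & w = g *m v]).

(* The map induced by f on T-points: the line T v goes to the line T f(v).     *)
Definition proj_map (R T : comPzRingType) (phi : {rmorphism R -> T})
    (n d : nat) (f : 'I_n -> hform R n d) (L : 'cV[T]_n -> Prop) :
    'cV[T]_n -> Prop :=
  modspan (fun w => exists2 v, L v & w = \col_i hform_eval phi (f i) v).

(* The map induced by f^alpha = alpha o f o alpha^-1 on T-points.              *)
Definition proj_map_conj (R T : comPzRingType) (phi : {rmorphism R -> T})
    (n d : nat) (f : 'I_n -> hform R n d) (alpha : 'M[T]_n -> Prop)
    (L : 'cV[T]_n -> Prop) : 'cV[T]_n -> Prop :=
  pgl_act alpha (proj_map phi f (pgl_act (pgl_inv alpha) L)).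

(* Aut_f(S) as a subset of PGL_n(S). The equality f^alpha = f of endomorphisms *)
(* of P^(n-1)_S means that they agree on T-points for every S-algebra T.       *)
Definition Aut_functor (R : comPzRingType) (n d : nat) (f : 'I_n -> hform R n d)
    (S : comPzRingType) (phi : {rmorphism R -> S}) (alpha : 'M[S]_n -> Prop) :
    Prop :=
  pgl_point alpha /\
  forall (T : comPzRingType) (h : {rmorphism S -> T}) (L : 'cV[T]_n -> Prop),
    proj_point L ->
    same_set
      (proj_map_conj (h \o phi : {rmorphism R -> T}) f (pgl_base h alpha) L)
      (proj_map (h \o phi : {rmorphism R -> T}) f L).

(* Given an R-algebra B and u in PGL_n(B), i.e. a morphism Spec B -> PGL_n over *)
(* R: the image of (Spec B)(S) in PGL_n(S).                                    *)
Definition image_points (R B : comPzRingType) (iota : {rmorphism R -> B})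
    (n : nat) (u : 'M[B]_n -> Prop)
    (S : comPzRingType) (phi : {rmorphism R -> S}) (alpha : 'M[S]_n -> Prop) :
    Prop :=
  exists h : {rmorphism B -> S},
    (forall x, h (iota x) = phi x) /\ same_set alpha (pgl_base h u).

(* Closed subschemes of PGL_n over R. As PGL_n is affine, they are morphisms   *)
(* Spec B -> PGL_n which are injective on points and whose pullback along any  *)
(* Spec S -> PGL_n is the closed subscheme V(J) for some ideal J of S.         *)
Record closed_subscheme_PGL (R : comPzRingType) (n : nat) := ClosedSubschemePGL {
  cs_ring : comPzRingType;
  cs_struct : {rmorphism R -> cs_ring};
  cs_univ : 'M[cs_ring]_n -> Prop;
  cs_univP : pgl_point cs_univ;
  cs_mono : forall (S : comPzRingType) (h h' : {rmorphism cs_ring -> S}),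
    (forall x, h (cs_struct x) = h' (cs_struct x)) ->
    same_set (pgl_base h cs_univ) (pgl_base h' cs_univ) ->
    h =1 h';
  cs_closed : forall (S : comPzRingType) (phi : {rmorphism R -> S})
      (alpha : 'M[S]_n -> Prop), pgl_point alpha ->
    exists2 J : S -> Prop, is_ideal J &
      forall (T : comPzRingType) (h : {rmorphism S -> T}),
        image_points cs_struct cs_univ (h \o phi : {rmorphism R -> T})
          (pgl_base h alpha)
        <-> forall x, J x -> h x = 0
}.

Definition cs_points (R : comPzRingType) (n : nat)
    (Z : closed_subscheme_PGL R n) (S : comPzRingType)
    (phi : {rmorphism R -> S}) (alpha : 'M[S]_n -> Prop) : Prop :=
  image_points (cs_struct Z) (@cs_univ _ _ Z) phi alpha.

Definition finite_scheme (R : comPzRingType) (n : nat)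
    (Z : closed_subscheme_PGL R n) : Prop :=
  module_finite (cs_struct Z).

Definition subgroup_scheme (R : comPzRingType) (n : nat)
    (Z : closed_subscheme_PGL R n) : Prop :=
  forall (S : comPzRingType) (phi : {rmorphism R -> S}),
    [/\ cs_points Z phi (@pgl_one S n),
        forall alpha beta, cs_points Z phi alpha -> cs_points Z phi beta ->
          cs_points Z phi (pgl_mul alpha beta) &
        forall alpha, cs_points Z phi alpha -> cs_points Z phi (pgl_inv alpha)].

Definition represents (R : comPzRingType) (n : nat)
    (Z : closed_subscheme_PGL R n)
    (H : forall S : comPzRingType, {rmorphism R -> S} ->
           ('M[S]_n -> Prop) -> Prop) : Prop :=
  forall (S : comPzRingType) (phi : {rmorphism R -> S})
    (alpha : 'M[S]_n -> Prop),
    cs_points Z phi alpha <-> H S phi alpha.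

(* Main.v *)
Require Import Defs.
From HB Require Import structures.
From mathcomp Require Import all_boot all_order all_algebra.
From mathcomp Require Import closed_field mpoly ring.
From Stdlib Require Import ClassicalEpsilon FunctionalExtensionality PropExtensionality.

(* Write p = g (x) g^-1 for the coordinates of the class of g in PGL, so that    *)
(* p_(ij,kl) = g_ij (g^-1)_kl. Since the resultant is a unit, for some e every   *)
(* x_i^e is a combination of the f_j with coefficients a_ij of degree e - d      *)
(* (otherwise the universal system would have a nontrivial zero with invertible  *)
(* resultant over some algebraically closed field). If f commutes with the class *)
(* of g, then f(gx) = c g f(x) for a scalar c, as a regular function on          *)
(* projective space is constant, and f(hx) = c^-1 h f(x) for h = g^-1. Taking   *)
(* x_i^e = \sum_s a_is(x) f_s(x) at the columns of g and of h and multiplying,   *)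
(* the scalars cancel and                                                        *)
(*   (g_ij h_kl)^e =                                                             *)
(*     \sum_(s, t) a_is(g e_j) a_kt(h e_l) (g f(e_j))_s (h f(e_l))_t,            *)
(* a form of degree e - d + 1 < e in the p's. So the coordinate ring is spanned  *)
(* over R by the monomials in the p's with all exponents less than e.            *)

Set Implicit Arguments.
Unset Strict Implicit.
Unset Printing Implicit Defensive.

Import GRing.Theory.
Local Open Scope ring_scope.

(** * Quotients and maximal ideals *)

(** The tensor p = g (x) g^-1 does not change when g is scaled. By [pgl_point_coords] and
    [coord_line_inj], the points of PGL over any ring, including lines not generated by one matrix,
    are exactly the solutions p of the polynomial equations [pgl_coords]. So PGL is handled as an
    affine scheme with coordinates p.

    A unit resultant yields identities x_k^(D+d) = \sum_i a_ki f_i valid over every R-algebra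
    ([resultant_certificate]). They serve three times. First, two systems of forms defining the same
    map differ by a constant ([proportional_forms]). Testing the functor at the generic point of a
    chart therefore shows that g f(g^-1 x) is a scalar multiple of f(x) identically in x
    ([functor_generic]); the converse is [equiv_at_conj]. Second, the scalar is itself a polynomial
    in the entries of the matrices ([factor]), so membership in Aut_f becomes the equational
    condition [aut_coords], stable under base change, product and inverse. The polynomials in p
    vanishing on all its solutions define [aut_ring], and the equations hold for the universal
    tensor ([univ_coordsP]); this gives representability and the closed subgroup structure. Third,
    they give [integral_equation]: the power D+d of each coordinate is a form of degree D+1 in the
    coordinates. As d is at least 2, this lowers the degree, and finitely many monomials span
    [aut_ring]. *)

Definition propb (P : Prop) : bool :=
  if excluded_middle_informative P then true else false.

Lemma propbP (P : Prop) : reflect P (propb P).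
Proof. by rewrite /propb; case: excluded_middle_informative => h; constructor. Qed.

Section Ideals.

Variables (A : comPzRingType) (I : A -> Prop) (idI : is_ideal I).

Lemma ideal0 : I 0. Proof. by case: idI. Qed.

Lemma idealMD a x y : I x -> I y -> I (a * x + y).
Proof. by case: idI => _; apply. Qed.

Lemma idealM a x : I x -> I (a * x).
Proof. by move=> Ix; rewrite -[a * x]addr0; apply: idealMD ideal0. Qed.

Lemma idealD x y : I x -> I y -> I (x + y).
Proof. by move=> Ix Iy; rewrite -[x]mul1r; apply: idealMD. Qed.

Lemma idealN x : I x -> I (- x).
Proof. by rewrite -mulN1r; apply: idealM. Qed.

Lemma idealB x y : I x -> I y -> I (x - y).
Proof. by move=> Ix /idealN; apply: idealD. Qed.

Lemma ideal_sum (J : Type) (r : seq J) (P : pred J) (F : J -> A) :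
  (forall i, P i -> I (F i)) -> I (\sum_(i <- r | P i) F i).
Proof. by move=> IF; elim/big_ind: _ => //; [exact: ideal0 | exact: idealD]. Qed.

End Ideals.

(** Each class has a canonical representative, and the quotient is the subtype of these. Equality of
    classes is then plain equality, and the choice structure is inherited from [A]. *)
Definition iquot_repr (A : comPzRingType) (I : A -> Prop) (x : A) : A :=
  choose (fun y => propb (I (x - y))) x.

Definition iquot (A : comPzRingType) (I : A -> Prop) of is_ideal I :=
  {x : A | iquot_repr I x == x}.

Section Quotient.

Variables (A : comPzRingType) (I : A -> Prop) (idI : is_ideal I).
Local Notation Q := (iquot idI).

Lemma iquot_reprP x : I (x - iquot_repr I x).
Proof.
apply/propbP/(@chooseP _ (fun y => propb (I (x - y)))).
by apply/propbP; rewrite subrr; apply: ideal0.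
Qed.

Lemma iquot_repr_eq x y : I (x - y) -> iquot_repr I x = iquot_repr I y.
Proof.
move=> Ixy; rewrite /iquot_repr; transitivity (choose (fun z => propb (I (x - z))) y).
  by apply: choose_id; apply/propbP; rewrite ?subrr //; apply: ideal0.
apply: eq_choose => z; apply/propbP/propbP => Iz.
  have -> : y - z = (x - z) - (x - y) by ring.
  exact: idealB.
have -> : x - z = (x - y) + (y - z) by ring.
exact: idealD.
Qed.

Lemma iquot_repr_id x : iquot_repr I (iquot_repr I x) == iquot_repr I x.
Proof.
apply/eqP/iquot_repr_eq; rewrite -opprB; apply: idealN => //.
exact: iquot_reprP.
Qed.

Definition ipi (x : A) : Q := exist _ (iquot_repr I x) (iquot_repr_id x).

HB.instance Definition _ := Choice.on Q.

Lemma ipi_eq x y : ipi x = ipi y <-> I (x - y).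
Proof.
split=> [/(congr1 val) /= exy | Ixy]; last exact/val_inj/iquot_repr_eq.
have -> : x - y = (x - iquot_repr I x) - (y - iquot_repr I y) by rewrite exy; ring.
by apply: idealB => //; apply: iquot_reprP.
Qed.

Lemma ipiK (u : Q) : ipi (val u) = u.
Proof. by apply: val_inj => /=; case: u => x /= /eqP. Qed.

Let add (u v : Q) := ipi (val u + val v).
Let opp (u : Q) := ipi (- val u).
Let mul (u v : Q) := ipi (val u * val v).

Let ipi_val x : I (val (ipi x) - x).
Proof. by rewrite -opprB; apply: idealN => //; apply: iquot_reprP. Qed.

Let addE x y : add (ipi x) (ipi y) = ipi (x + y).
Proof.
apply/ipi_eq; have -> a b : a + b - (x + y) = (a - x) + (b - y) by ring.
by apply: idealD => //; apply: ipi_val.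
Qed.

Let oppE x : opp (ipi x) = ipi (- x).
Proof.
apply/ipi_eq; rewrite -opprD; apply: idealN => //; exact: ipi_val.
Qed.

Let mulE x y : mul (ipi x) (ipi y) = ipi (x * y).
Proof.
apply/ipi_eq; have -> a b : a * b - x * y = a * (b - y) + y * (a - x) by ring.
by apply: idealMD => //; apply: idealM.
Qed.

Let addA : associative add.
Proof. by move=> u v w; rewrite -(ipiK u) -(ipiK v) -(ipiK w) !addE addrA. Qed.
Let addC : commutative add.
Proof. by move=> u v; rewrite -(ipiK u) -(ipiK v) !addE addrC. Qed.
Let add0 : left_id (ipi 0) add.
Proof. by move=> u; rewrite -(ipiK u) !addE add0r. Qed.
Let addN : left_inverse (ipi 0) opp add.
Proof. by move=> u; rewrite -(ipiK u) oppE !addE addNr. Qed.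

HB.instance Definition _ := GRing.isZmodule.Build Q addA addC add0 addN.

Let mulA : associative mul.
Proof. by move=> u v w; rewrite -(ipiK u) -(ipiK v) -(ipiK w) !mulE mulrA. Qed.
Let mulC : commutative mul.
Proof. by move=> u v; rewrite -(ipiK u) -(ipiK v) !mulE mulrC. Qed.
Let mul1 : left_id (ipi 1) mul.
Proof. by move=> u; rewrite -(ipiK u) !mulE mul1r. Qed.
Let mulD : left_distributive mul +%R.
Proof.
by move=> u v w; rewrite -(ipiK u) -(ipiK v) -(ipiK w);
  rewrite /GRing.add /= addE !mulE addE mulrDl.
Qed.

HB.instance Definition _ :=
  GRing.Zmodule_isComPzRing.Build Q mulA mulC mul1 mulD.

Lemma ipi_is_zmod_morphism : zmod_morphism ipi.
Proof. by move=> x y; rewrite -addE -oppE. Qed.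

Lemma ipi_is_monoid_morphism : monoid_morphism ipi.
Proof. by split=> // x y; rewrite -mulE. Qed.

HB.instance Definition _ := GRing.isZmodMorphism.Build A Q ipi ipi_is_zmod_morphism.
HB.instance Definition _ :=
  GRing.isMonoidMorphism.Build A Q ipi ipi_is_monoid_morphism.

Lemma ipi_eq0 x : ipi x = 0 <-> I x.
Proof. by rewrite -(rmorph0 ipi) ipi_eq subr0. Qed.

Section Lift.

Variables (T : comPzRingType) (h : {rmorphism A -> T}).
Hypothesis hI : forall x, I x -> h x = 0.

Definition iquot_lift of (forall x, I x -> h x = 0) := fun u : Q => h (val u).

Lemma iquot_liftE x : iquot_lift hI (ipi x) = h x.
Proof.
by apply/eqP; rewrite eq_sym -subr_eq0 -rmorphB hI //; apply: iquot_reprP.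
Qed.

Let lift_is_zmod_morphism : zmod_morphism (iquot_lift hI).
Proof.
by move=> u v; rewrite -(ipiK u) -(ipiK v) -rmorphB !iquot_liftE rmorphB.
Qed.

Let lift_is_monoid_morphism : monoid_morphism (iquot_lift hI).
Proof.
split=> [|u v]; first by rewrite -(rmorph1 ipi) iquot_liftE rmorph1.
by rewrite -(ipiK u) -(ipiK v) -rmorphM !iquot_liftE rmorphM.
Qed.

HB.instance Definition _ :=
  GRing.isZmodMorphism.Build Q T (iquot_lift hI) lift_is_zmod_morphism.
HB.instance Definition _ :=
  GRing.isMonoidMorphism.Build Q T (iquot_lift hI) lift_is_monoid_morphism.

End Lift.

End Quotient.

Section MaximalIdeal.

Variables (A : comPzRingType) (I : A -> Prop) (idI : is_ideal I).
Variables (pk : A -> nat) (upk : nat -> option A) (pkK : pcancel pk upk).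

Definition ideal_adjoin (J : A -> Prop) (a : A) : A -> Prop :=
  fun x => exists c y, J y /\ x = c * a + y.

Lemma ideal_adjoinP J a : is_ideal J -> is_ideal (ideal_adjoin J a).
Proof.
move=> idJ; split; first by exists 0, 0; rewrite mul0r addr0; split => //; case: idJ.
move=> b _ _ [c [y [Jy ->]]] [c' [y' [Jy' ->]]].
exists (b * c + c'), (b * y + y'); split; first exact: (idealMD idJ).
by rewrite /GRing.scale /=; ring.
Qed.

(** The elements of the countable ring are adjoined one after the other, skipping those that would
    produce the unit ideal; the union of the chain is maximal. *)
Fixpoint ideal_chain (k : nat) : A -> Prop :=
  if k is k'.+1 then
    let J := if upk k' is Some a then ideal_adjoin (ideal_chain k') a
             else ideal_chain k' in
    if propb (J 1) then ideal_chain k' else J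
  else I.

Lemma ideal_chainP k : is_ideal (ideal_chain k).
Proof.
elim: k => [|k IHk] //=; case: propbP => // _.
by case: upk => [a|] //; apply: ideal_adjoinP.
Qed.

Lemma ideal_chain_proper k : ~ I 1 -> ~ ideal_chain k 1.
Proof. by move=> nI1; elim: k => [|k IHk] //=; case: propbP. Qed.

Lemma ideal_chain_mono k l x : (k <= l)%N -> ideal_chain k x -> ideal_chain l x.
Proof.
elim: l => [|l IHl]; first by rewrite leqn0 => /eqP->.
rewrite leq_eqVlt => /predU1P[-> //|]; rewrite ltnS => /IHl {}IHl /IHl Jx /=.
case: propbP => // _; case: upk => // a.
by exists 0, x; rewrite mul0r add0r.
Qed.

Lemma exists_maximal_ideal : ~ I 1 ->
  exists M : A -> Prop, [/\ is_ideal M, forall x, I x -> M x, ~ M 1 &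
    forall a, ~ M a -> exists c, M (c * a - 1)].
Proof.
move=> nI1; exists (fun x => exists k, ideal_chain k x); split.
- split; first by exists 0%N; case: idI.
  move=> a x y [k Jx] [l Jy]; exists (maxn k l).
  have [_] := ideal_chainP (maxn k l); apply.
    exact: ideal_chain_mono (leq_maxl _ _) Jx.
  exact: ideal_chain_mono (leq_maxr _ _) Jy.
- by move=> x Ix; exists 0%N.
- by case=> k; apply: ideal_chain_proper.
(* Stage [pk a] decides about [a]: either adjoining it gives 1, which exhibits an inverse of [a]
   modulo the ideal, or [a] was adjoined. *)
move=> a nMa; case: (propbP (ideal_adjoin (ideal_chain (pk a)) a 1)).
  case=> c [y [Jy e1]]; exists c, (pk a).
  have -> : c * a - 1 = - y by rewrite e1; ring.
  by apply: (idealN (ideal_chainP _)).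
move=> n1; case: nMa; exists (pk a).+1; rewrite /= pkK; case: propbP => // _.
exists 1, 0; rewrite mul1r addr0; split=> //; exact: (ideal0 (ideal_chainP _)).
Qed.

End MaximalIdeal.

Section ResidueField.

Variables (A : comPzRingType) (M : A -> Prop) (idM : is_ideal M).
Variables (pk : A -> nat) (upk : nat -> option A) (pkK : pcancel pk upk).
Hypothesis M1 : ~ M 1.
Hypothesis maxM : forall a, ~ M a -> exists c, M (c * a - 1).
Local Notation Q := (iquot idM).

Let inv (u : Q) : Q :=
  if u == 0 then 0 else epsilon (inhabits 0) (fun v : Q => v * u = 1).

Let invP (u : Q) : u != 0 -> inv u * u = 1.
Proof.
move=> u0; rewrite /inv (negPf u0); apply: (epsilon_spec _ (fun v : Q => v * u = 1)).
have /maxM[c Mc] : ~ M (val u).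
  by move=> Mu; case/eqP: u0; rewrite -(ipiK u); apply/ipi_eq0.
exists (ipi idM c); rewrite -(ipiK u) -rmorphM -(rmorph1 (ipi idM)).
exact/ipi_eq.
Qed.

Let inv0 : inv 0 = 0. Proof. by rewrite /inv eqxx. Qed.

Let oner_neq0 : (1 : Q) != 0.
Proof. by apply/eqP; rewrite -(rmorph1 (ipi idM)) => /ipi_eq0. Qed.

Let upkQ (k : nat) : option Q := omap (ipi idM) (upk k).

Let pkQK : pcancel (fun u : Q => pk (val u)) upkQ.
Proof. by move=> u; rewrite /upkQ pkK /= ipiK. Qed.

Lemma residue_closed_field :
  exists (K : closedFieldType) (h : {rmorphism A -> K}), forall x, M x -> h x = 0.
Proof.
pose nzQ := GRing.PzSemiRing_isNonZero.Build Q oner_neq0.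
pose Q1 : comNzRingType := HB.pack Q nzQ.
pose fQ := GRing.ComNzRing_isField.Build Q1 invP inv0.
pose cQ := Choice_isCountable.Build Q pkQK.
pose F : countFieldType := HB.pack Q nzQ fQ cQ.
have [K [FtoK _]] := countable_algebraic_closure F.
pose pF := (ipi idM : {rmorphism A -> F}).
exists K, (FtoK \o pF : {rmorphism A -> K}) => x Mx /=.
by rewrite (_ : ipi idM x = 0 :> F) ?rmorph0 //; apply/ipi_eq0.
Qed.

End ResidueField.

Lemma mpoly_int_countable (n : nat) :
  exists (pk : {mpoly int[n]} -> nat) (upk : nat -> option {mpoly int[n]}),
    pcancel pk upk.
Proof.
pose enc (p : {mpoly int[n]}) := [seq (m, p@_m) | m <- msupp p].
pose dec (s : seq ('X_{1..n} * int)) : {mpoly int[n]} :=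
  \sum_(x <- s) x.2 *: 'X_[x.1].
exists (fun p => pickle (enc p)), (fun k => omap dec (unpickle k)) => p.
by rewrite pickleK /=; congr Some; rewrite /dec big_map -mpolyE.
Qed.

(* Countability of the ring is what makes countable_algebraic_closure apply. *)
Lemma mpoly_int_closed_point (n : nat) (I : {mpoly int[n]} -> Prop) :
  is_ideal I -> ~ I 1 ->
  exists (K : closedFieldType) (h : {rmorphism {mpoly int[n]} -> K}),
    forall x, I x -> h x = 0.
Proof.
move=> idI nI1; have [pk [upk pkK]] := mpoly_int_countable n.
have [M [idM IM M1 maxM]] := exists_maximal_ideal idI pkK nI1.
have [K [h hM]] := residue_closed_field idM pkK M1 maxM.
by exists K, h => x /IM/hM.
Qed.

(** * Evaluation of polynomials and forms, zero rings included *)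

Lemma zero_ring_eq (T : comPzRingType) : (1 : T) = 0 -> forall x y : T, x = y.
Proof. by move=> e x y; rewrite -[x]mul1r -[y]mul1r e !mul0r. Qed.

Definition nz_ring (T : comPzRingType) (h : (1 : T) != 0) : comNzRingType :=
  HB.pack T (GRing.PzSemiRing_isNonZero.Build T h).

Lemma comNzRing_ind (P : comPzRingType -> Prop) :
  (forall S : comNzRingType, P S) -> forall S : comPzRingType, (1 : S) != 0 -> P S.
Proof. by move=> PN [S cS] nzS; have := PN (nz_ring nzS). Qed.

Section PolyEval.

Variables (R : comNzRingType) (T : comPzRingType) (phi : {rmorphism R -> T}).
Variables (n : nat) (v : 'I_n -> T).

(** The target may be the zero ring, where every identity is trivial; otherwise this is [mmap]. *)
Definition pev (p : {mpoly R[n]}) : T :=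
  \sum_(m <- msupp p) phi p@_m * \prod_(i < n) v i ^+ m i.

Lemma pev_is_zmod_morphism : zmod_morphism pev.
Proof.
have [e|nzT] := eqVneq (1 : T) 0; first by move=> p q; apply: zero_ring_eq.
exact: (@raddfB _ _ (mmap (phi : {rmorphism R -> nz_ring nzT}) v)).
Qed.

Lemma pev_is_monoid_morphism : monoid_morphism pev.
Proof.
have [e|nzT] := eqVneq (1 : T) 0; first by split=> [|p q]; apply: zero_ring_eq.
split; first exact: (@rmorph1 _ _ (mmap (phi : {rmorphism R -> nz_ring nzT}) v)).
exact: (@rmorphM _ _ (mmap (phi : {rmorphism R -> nz_ring nzT}) v)).
Qed.

HB.instance Definition _ :=
  GRing.isZmodMorphism.Build {mpoly R[n]} T pev pev_is_zmod_morphism.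
HB.instance Definition _ :=
  GRing.isMonoidMorphism.Build {mpoly R[n]} T pev pev_is_monoid_morphism.

Lemma pevC c : pev c%:MP = phi c.
Proof.
have [->|nz_c] := eqVneq c 0; first by rewrite mpolyC0 !rmorph0.
rewrite /pev msuppC (negPf nz_c) big_seq1 mcoeffC eqxx mulr1 big1 ?mulr1 // => i _.
by rewrite mnm0E.
Qed.

Lemma pevXm m : pev 'X_[m] = \prod_(i < n) v i ^+ m i.
Proof. by rewrite /pev msuppX big_seq1 mcoeffX eqxx rmorph1 mul1r. Qed.

Lemma pevX i : pev 'X_i = v i.
Proof.
rewrite pevXm (bigD1 i) //= mnm1E eqxx expr1 big1 ?mulr1 // => j ji.
by rewrite mnm1E eq_sym (negPf ji).
Qed.

End PolyEval.

Lemma mdeg_monomial (n d : nat) (m : monomial n d) : mdeg (val m : 'X_{1..n}) = d.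
Proof. exact/eqP/(valP m). Qed.

Section FormEval.

Variables (R : comPzRingType) (n d : nat).
Implicit Types F : hform R n d.

Lemma eq_hform_eval (T : comPzRingType) (phi psi : {rmorphism R -> T}) F x :
  phi =1 psi -> hform_eval phi F x = hform_eval psi F x.
Proof. by move=> e; apply: eq_bigr => m _; rewrite e. Qed.

Lemma rmorph_hform_eval (T T' : comPzRingType) (phi : {rmorphism R -> T})
    (psi : {rmorphism R -> T'}) (h : {rmorphism T -> T'}) F x :
  (forall r, h (phi r) = psi r) ->
  h (hform_eval phi F x) = hform_eval psi F (map_mx h x).
Proof.
move=> e; rewrite rmorph_sum; apply: eq_bigr => m _.
rewrite rmorphM e rmorph_prod; congr (_ * _); apply: eq_bigr => j _.
by rewrite mxE rmorphXn.
Qed.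

Lemma hform_evalZ (T : comPzRingType) (phi : {rmorphism R -> T}) F c x :
  hform_eval phi F (c *: x) = c ^+ d * hform_eval phi F x.
Proof.
rewrite /hform_eval mulr_sumr; apply: eq_bigr => m _.
rewrite mulrCA; congr (_ * _).
have <- : c ^+ mdeg (val m : 'X_{1..n}) = c ^+ d by rewrite mdeg_monomial.
rewrite mdegE -prodrXr -big_split /=.
by apply: eq_bigr => j _; rewrite mxE exprMn.
Qed.

End FormEval.

Lemma rmorph_coef_eval (n d : nat) (P : Defs.coef_poly n d) (S T : comPzRingType)
    (h : {rmorphism S -> T}) (F : 'I_n -> hform S n d) :
  h (coef_eval P F) = coef_eval P (fun i m => h (F i m)).
Proof.
rewrite rmorph_sum; apply: eq_bigr => m _; rewrite rmorphM rmorph_int.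
by rewrite rmorph_prod; congr (_ * _); apply: eq_bigr => k _; rewrite rmorphXn.
Qed.

Lemma pev_ext (R : comNzRingType) (T : comPzRingType) (n : nat)
    (h h' : {rmorphism {mpoly R[n]} -> T}) :
  (forall c, h c%:MP = h' c%:MP) -> (forall i, h 'X_i = h' 'X_i) -> h =1 h'.
Proof.
move=> eC eX p; rewrite [p]mpolyE !rmorph_sum; apply: eq_bigr => m _.
rewrite -mul_mpolyC !rmorphM eC; congr (_ * _).
by rewrite mpolyXE_id !rmorph_prod; apply: eq_bigr => i _; rewrite !rmorphXn eX.
Qed.

Lemma mcoeff_pev (R S : comNzRingType) (n : nat) (g : {rmorphism R -> S})
    (phi : {rmorphism R -> {mpoly S[n]}}) (p : {mpoly R[n]}) m :
  (forall r, phi r = (g r)%:MP) -> (pev phi (fun i => 'X_i) p)@_m = g p@_m.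
Proof.
move=> e; rewrite /pev raddf_sum /=.
under eq_bigr do rewrite e -mpolyXE_id mcoeffCM mcoeffX.
have [mp|mNp] := boolP (m \in msupp p).
  rewrite (bigD1_seq m) ?msupp_uniq //= eqxx mulr1 big1 ?addr0 // => m' /negPf->.
  by rewrite mulr0.
rewrite (memN_msupp_eq0 mNp) rmorph0 big_seq big1 // => m' m'p.
by case: eqP m'p mNp => [->|]; rewrite ?mulr0 // => ->.
Qed.

Lemma sum_monomial (T : nmodType) (n d : nat) (F : 'X_{1..n} -> T) :
  \sum_(m : monomial n d) F (val m) =
  \sum_(m : 'X_{1..n < d.+1} | mdeg m == d) F m.
Proof.
rewrite (reindex_omap (val : monomial n d -> _) insub) /=; last first.
  by move=> m md; rewrite insubT.
by apply: eq_bigl => -[m md] /=; rewrite md insubT /= eqxx.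
Qed.

Lemma pev_homog (R : comNzRingType) (T : comPzRingType) (phi : {rmorphism R -> T})
    (n d : nat) (p : {mpoly R[n]}) (x : 'cV[T]_n) : p \is d.-homog ->
  pev phi (fun i => x i 0) p = hform_eval phi (fun m : monomial n d => p@_(val m)) x.
Proof.
move=> /dhomogP hp; rewrite /hform_eval.
pose G (m : 'X_{1..n}) := phi p@_m * \prod_(j < n) x j 0 ^+ m j.
rewrite (sum_monomial d G) /pev -/(G _).
pose I : subFinType _ := 'X_{1..n < d.+1}.
have supp0 m : m \notin msupp p -> G m = 0.
  by move/memN_msupp_eq0; rewrite /G => ->; rewrite rmorph0 mul0r.
rewrite (ssrcomplements.big_mksub I) ?msupp_uniq //=; last first.
  by move=> m /hp ->.
rewrite [RHS](bigID (fun m : I => val m \in msupp p)) /= [X in _ = _ + X]big1 ?addr0.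
  apply: eq_big => m //=; case: (boolP (_ \in _)); rewrite ?andbF //.
  by move=> /hp ->; rewrite eqxx.
by move=> m /andP[_ /supp0].
Qed.

Lemma hform_eval_homog (R : comPzRingType) (S : comNzRingType)
    (n d k : nat) (phi : {rmorphism R -> {mpoly S[n]}}) (F : hform R n d)
    (x : 'cV[{mpoly S[n]}]_n) :
  (forall m, phi m \is 0.-homog) -> (forall i, x i 0 \is k.-homog) ->
  hform_eval phi F x \is (k * d).-homog.
Proof.
move=> hphi hx; apply: rpred_sum => m _; rewrite -[(k * d)%N]add0n.
apply: dhomogM => //; move: (bmnm (val m)) (mdeg_monomial m) => mu <-.
rewrite mdegE big_distrr /=.
elim/big_rec2: _ => [|j p q _ hq]; first exact: dhomog1.
by apply: dhomogM => //; apply: dhomogMn.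
Qed.

Lemma hform_eval_homog1 (R : comPzRingType) (S : comNzRingType)
    (n d : nat) (phi : {rmorphism R -> {mpoly S[n]}}) (F : hform R n d)
    (x : 'cV[{mpoly S[n]}]_n) :
  (forall m, phi m \is 0.-homog) -> (forall i, x i 0 \is 1.-homog) ->
  hform_eval phi F x \is d.-homog.
Proof. by move=> hphi hx; have := hform_eval_homog F hphi hx; rewrite mul1n. Qed.

Lemma mpolyC_homog (S : comNzRingType) (n : nat) (c : S) :
  (c%:MP : {mpoly S[n]}) \is 0.-homog.
Proof. by rewrite -[_%:MP]mulr1 mul_mpolyC; apply/dhomogZ/dhomog1. Qed.

Lemma prod_m2s (T : comPzRingType) (n : nat) (m : 'X_{1..n}) (y : 'I_n -> T) :
  \prod_(i <- m2s m) y i = \prod_i y i ^+ m i.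
Proof.
rewrite /m2s big_flatten big_map big_enum /=; apply: eq_bigr => i _.
by rewrite big_nseq iter_mulr_1.
Qed.

(** Two monomials of the same degree, written as lists of variables, are paired off. This turns a
    monomial in g times one in g^-1 into a monomial in the products g_ij (g^-1)_kl. *)
Lemma prod_zip (T : comPzRingType) (I J : Type) (y : I -> T) (w : J -> T) r r' :
  size r = size r' ->
  \prod_(z <- zip r r') (y z.1 * w z.2) = (\prod_(i <- r) y i) * \prod_(j <- r') w j.
Proof.
move: r r'; apply: seq_ind2 => [|i j r r' _ IH]; first by rewrite !big_nil mulr1.
by rewrite !big_cons IH mulrACA.
Qed.

(** * Dehomogenization and proportional systems of forms *)

Section Dehomogenization.

Variables (S : comNzRingType) (n : nat) (k : 'I_n).

Definition chart_var (i : 'I_n) : {mpoly S[n]} := if i == k then 1 else 'X_i.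

Definition dehomog : {mpoly S[n]} -> {mpoly S[n]} := pev (@mpolyC n S) chart_var.
HB.instance Definition _ := GRing.RMorphism.on dehomog.

Lemma dehomog_chart i : dehomog (chart_var i) = chart_var i.
Proof.
rewrite /chart_var; case: (altP (i =P k)) => ik; first by rewrite rmorph1.
by rewrite /dehomog pevX /chart_var (negPf ik).
Qed.

Let cut (m : 'X_{1..n}) := [multinom (if i == k then 0%N else m i) | i < n].

Let chart_cut (m : 'X_{1..n}) : \prod_(i < n) chart_var i ^+ m i = 'X_[cut m].
Proof.
rewrite mpolyXE_id; apply: eq_bigr => i _; rewrite mnmE /chart_var.
by case: eqP => // _; rewrite expr1n expr0.
Qed.

Let cut_inj m m' : cut m = cut m' -> mdeg m = mdeg m' -> m = m'.
Proof.
move=> /mnmP ecut; have ek i : i != k -> m i = m' i.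
  by move=> ik; move: (ecut i); rewrite !mnmE (negPf ik).
rewrite !mdegE (bigD1 k) //= [in RHS](bigD1 k) //=.
rewrite (eq_bigr (fun i => m' i)); last by move=> i /ek.
move=> /addIn ekk; apply/mnmP => i.
by have [->|/ek] := eqVneq i k.
Qed.

(** A monomial of known degree is determined by its exponents away from [k], so setting the variable
    [k] to 1 causes no cancellation. *)
Lemma dehomog_eq0 (e : nat) (p : {mpoly S[n]}) :
  p \is e.-homog -> dehomog p = 0 -> p = 0.
Proof.
move=> hp p0; apply/mpolyP => m; rewrite mcoeff0.
have [mp|/memN_msupp_eq0 //] := boolP (m \in msupp p).
move/(congr1 (mcoeff (cut m))): p0; rewrite mcoeff0 /dehomog /pev raddf_sum /=.
rewrite (bigD1_seq m) ?msupp_uniq //= chart_cut mcoeffCM mcoeffX eqxx mulr1.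
rewrite big_seq_cond big1 ?addr0 // => m' /andP[m'p neq].
rewrite chart_cut mcoeffCM mcoeffX; case: eqP => [ecut|]; last by rewrite mulr0.
case/eqP: neq; apply: cut_inj => //.
by rewrite (dhomog_mf hp mp) (dhomog_mf hp m'p).
Qed.

End Dehomogenization.

Section Proportional.

Variables (S : comNzRingType) (n d D : nat) (k : 'I_n).
Variables (F H : 'I_n -> {mpoly S[n]}) (a : 'I_n -> 'I_n -> {mpoly S[n]}).
Hypotheses (hF : forall i, F i \is d.-homog) (hH : forall i, H i \is d.-homog).
Hypothesis (ha : forall i j, a i j \is D.-homog).
Hypothesis (aF : forall i, 'X_i ^+ (D + d) = \sum_j a i j * F j).

Let mulXn_inj (l : 'I_n) e (p q : {mpoly S[n]}) :
  p * 'X_l ^+ e = q * 'X_l ^+ e -> p = q.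
Proof.
rewrite mpolyXn => epq; apply/mpolyP => m.
by rewrite -(mcoeffMX p (U_(l) *+ e)) -(mcoeffMX q (U_(l) *+ e)) epq.
Qed.

(* Both systems define the same rational map, and the ratio of H to F is a      *)
(* regular function on projective space, hence constant.                        *)
Lemma proportional_forms (L : {mpoly S[n]}) :
  (forall i, dehomog k (H i) = L * dehomog k (F i)) ->
  exists c : S, forall i, H i = c%:MP * F i.
Proof.
move=> HL.
have minor i j : H i * F j = H j * F i.
  apply/eqP; rewrite -subr_eq0; apply/eqP.
  apply: (@dehomog_eq0 _ _ k (d + d)); last by rewrite rmorphB !rmorphM /= !HL; ring.
  by apply: rpredB; apply: dhomogM.
pose Lam i := \sum_j a i j * H j.
have XH i j : 'X_i ^+ (D + d) * H j = Lam i * F j.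
  rewrite aF !mulr_suml; apply: eq_bigr => l _.
  by rewrite -!mulrA [F l * _]mulrC minor.
(* [Lam i / 'X_i ^+ (D + d)] is the ratio of H to F on the chart i; these agree on overlaps. The
   extra power of ['X_k] is expanded by [aF] so that [XH] applies. *)
have LamX i l : Lam i * 'X_l ^+ (D + d) = Lam l * 'X_i ^+ (D + d).
  apply: (@mulXn_inj k (D + d)); rewrite [in 'X_k ^+ _]aF !mulr_sumr.
  apply: eq_bigr => j _; rewrite ![_ * (a k j * _)]mulrCA; congr (_ * _).
  rewrite -[LHS]mulrA -[RHS]mulrA ![_ ^+ _ * F j]mulrC !mulrA -!XH; ring.
have hLam i : Lam i \is (D + d).-homog by apply: rpred_sum => j _; apply: dhomogM.
pose c := (Lam k)@_(U_(k) *+ (D + d)).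
have LamE : Lam k = c%:MP * 'X_k ^+ (D + d).
  rewrite mpolyXn; apply/mpolyP => m; rewrite mcoeffCM mcoeffX.
  case: eqP => [<-|mU]; rewrite ?mulr1 ?mulr0 //.
  have [md|] := eqVneq (mdeg m) (D + d)%N; last exact: dhomog_nemf_coeff.
  have [l lk ml] : exists2 l, l != k & m l != 0%N.
    case: (pickP (fun l => (l != k) && (m l != 0%N))) => [l /andP[]|m0]; first by exists l.
    have mi i : i != k -> m i = 0%N by move=> ik; move: (m0 i); rewrite ik => /negbFE/eqP.
    case: mU; apply/mnmP => i; rewrite mulmnE mnm1E.
    have [<-|ik] := eqVneq k i; last by rewrite mul0n mi // eq_sym.
    by rewrite mul1n -md mdegE (bigD1 k) //= big1 ?addn0.
  (* The coefficient of m in [Lam k] is that of m times X_l^(D+d) in Lam l * X_k^(D+d). If nonzero,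
     it forces m k >= D + d, against m l > 0 and the degree of m. *)
  rewrite -(mcoeffMX (Lam k) (U_(l) *+ (D + d))) -mpolyXn LamX mpolyXn.
  apply: memN_msupp_eq0; rewrite (perm_mem (msuppMX _ _)).
  apply/negP => /mapP[m' _ /mnmP/(_ k)]; rewrite !mnmDE !mulmnE !mnm1E eqxx mul1n.
  rewrite (negPf lk) mul0n add0n => mk.
  move: md; rewrite mdegE (bigD1 k) //= (bigD1 l) //= mk => /eqP.
  by case: (m l) ml => // ml _; rewrite -addnA -[X in _ == X]addn0 eqn_add2l addnCA.
exists c => i; apply: (@mulXn_inj k (D + d)).
by rewrite mulrC XH LamE; ring.
Qed.

End Proportional.

(** * An effective Nullstellensatz from the resultant *)

Section ChartCertificate.

Variables (n d : nat) (Res : Defs.coef_poly n d) (k : 'I_n).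
Hypothesis ResP : macaulay_resultant Res.

(* The universal system: its coefficients, an inverse of its resultant, and the *)
(* homogeneous coordinates of a point.                                          *)
Let idx : finType := (coef_index n d + option 'I_n)%type.
Let U := {mpoly int[#|idx|]}.
Let var (i : idx) : U := 'X_(enum_rank i).
Let uF (i : 'I_n) : hform U n d := fun m => var (inl (i, m)).
Let ub : U := var (inr None).
Let ux : 'cV[U]_n := \col_j var (inr (Some j)).
Let idU : {rmorphism U -> U} := idfun.

Definition univ_ideal (p : U) : Prop := exists (c e : U) (A : 'I_n -> U),
  p = c * (coef_eval Res uF * ub - 1) + e * (ux k 0 - 1)
      + \sum_i A i * hform_eval idU (uF i) ux.

Lemma univ_idealP : is_ideal univ_ideal.
Proof.
split.
  exists 0, 0, (fun=> 0); rewrite !mul0r !add0r big1 // => i _.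
  by rewrite mul0r.
move=> a _ _ [c [e [A ->]]] [c' [e' [A' ->]]].
exists (a * c + c'), (a * e + e'), (fun i => a * A i + A' i).
rewrite [in RHS](eq_bigr (fun i => a * (A i * hform_eval idU (uF i) ux) +
   A' i * hform_eval idU (uF i) ux)); last by move=> i _; ring.
rewrite big_split -mulr_sumr /= /GRing.scale /=; ring.
Qed.

(** Otherwise the ideal has a zero over some algebraically closed field: a system with invertible
    resultant and a common zero whose coordinate [k] is 1, contrary to the defining property of the
    resultant. *)
Lemma univ_ideal1 : univ_ideal 1.
Proof.
case: (propbP (univ_ideal 1)) => // n1.
have [K [h hI]] := mpoly_int_closed_point univ_idealP n1.
have hR : h (coef_eval Res uF) * h ub = 1.
  apply/eqP; rewrite -subr_eq0 -rmorphM -(rmorph1 h) -rmorphB; apply/eqP/hI.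
  exists 1, 0, (fun=> 0); rewrite mul1r mul0r addr0 big1 ?addr0 // => i _.
  by rewrite mul0r.
have hx : h (ux k 0) = 1.
  apply/eqP; rewrite -subr_eq0 -(rmorph1 h) -rmorphB; apply/eqP/hI.
  exists 0, 1, (fun=> 0); rewrite mul1r mul0r add0r big1 ?addr0 // => i _.
  by rewrite mul0r.
have [_ /(_ K (fun i m => h (uF i m))) [_ res0] _] := ResP.
move: hR; rewrite rmorph_coef_eval res0 ?mul0r; first by move/esym/eqP; rewrite oner_eq0.
exists (map_mx h ux).
  by apply: contraTneq isT => /matrixP/(_ k 0); rewrite mxE hx mxE => /eqP; rewrite oner_eq0.
move=> i; transitivity (h (hform_eval idU (uF i) ux)).
  by rewrite rmorph_sum; apply: eq_bigr => m _; rewrite rmorphM rmorph_prod;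
    congr (_ * _); apply: eq_bigr => j _; rewrite rmorphXn mxE.
apply: hI; exists 0, 0, (fun j => (i == j)%:R).
rewrite !mul0r !add0r (bigD1 i) //= eqxx mul1r big1 ?addr0 // => j /negPf ji.
by rewrite eq_sym ji mul0r.
Qed.

(** The universal identity [univ_ideal1] is specialized at the coefficients of [f], the inverse [b]
    and the vector [x]; its first two generators then vanish. *)
Lemma chart_certificate (R : comPzRingType) (f : 'I_n -> hform R n d) (b : R) :
  coef_eval Res f * b = 1 ->
  forall (T : comNzRingType) (phi : {rmorphism R -> T}) (x : 'cV[T]_n), x k 0 = 1 ->
  exists A : 'I_n -> T, \sum_i A i * hform_eval phi (f i) x = 1.
Proof.
move=> fb T phi x xk.
pose v (i : idx) : T := match i with
  | inl im => phi (f im.1 im.2) | inr None => phi b | inr (Some j) => x j 0 end.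
pose h : {rmorphism U -> T} := pev (intr : {rmorphism int -> T}) (fun i => v (enum_val i)).
have hv i : h (var i) = v i by rewrite /h /var /= pevX enum_rankK.
have [c [e [A e1]]] := univ_ideal1.
exists (fun i => h (A i)); rewrite -(rmorph1 h) e1 !rmorphD !rmorphM !rmorphB /=.
rewrite rmorphM rmorph_coef_eval (_ : h ub = phi b) ?hv // !rmorph1 mxE hv /= xk subrr mulr0.
rewrite (_ : coef_eval _ _ = phi (coef_eval Res f)).
  rewrite -rmorphM fb rmorph1 subrr mulr0 !add0r rmorph_sum; apply: eq_bigr => i _.
  rewrite rmorphM; congr (_ * _); rewrite rmorph_sum; apply: eq_bigr => m _.
  rewrite rmorphM rmorph_prod /= hv /=; congr (_ * _).
  by apply: eq_bigr => j _; rewrite rmorphXn mxE hv.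
rewrite rmorph_coef_eval; apply: eq_bigr => m _; congr (_ * _).
by apply: eq_bigr => j _; rewrite /uF hv.
Qed.

End ChartCertificate.

Section Homogenize.

Variables (R : comNzRingType) (n : nat) (k : 'I_n) (D : nat).

Definition homogenize (p : {mpoly R[n]}) : {mpoly R[n]} :=
  \sum_(m <- msupp p) p@_m *: ('X_[m] * 'X_k ^+ (D - mdeg m)).

Lemma homogenize_homog p : (msize p <= D.+1)%N -> homogenize p \is D.-homog.
Proof.
move=> szp; rewrite /homogenize big_seq; apply: rpred_sum => m mp.
apply: dhomogZ; rewrite mpolyXn -mpolyXD dhomogX /= mdegD mdegMn mdeg1 mul1n.
rewrite subnKC // -ltnS; exact: leq_trans (msize_mdeg_lt mp) szp.
Qed.

Lemma dehomog_homogenize p : dehomog k (homogenize p) = dehomog k p.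
Proof.
rewrite {2}[p]mpolyE !rmorph_sum; apply: eq_bigr => m _ /=.
rewrite -!mul_mpolyC !rmorphM rmorphXn /= /dehomog.
by rewrite !pevX /chart_var eqxx expr1n mulr1.
Qed.

End Homogenize.

(** The chart certificates at the generic points of the charts are homogenized. The resulting
    identities of forms hold because they hold after dehomogenization, and they can be evaluated in
    any algebra. *)
Lemma resultant_certificate (R : comNzRingType) (n d : nat)
    (f : 'I_n -> hform R n d) (Res : Defs.coef_poly n d) (b : R) :
  macaulay_resultant Res -> coef_eval Res f * b = 1 ->
  exists (D : nat) (a : 'I_n -> 'I_n -> hform R n D),
  forall (T : comPzRingType) (phi : {rmorphism R -> T}) (x : 'cV[T]_n) (k : 'I_n),
    x k 0 ^+ (D + d) = \sum_i hform_eval phi (a k i) x * hform_eval phi (f i) x.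
Proof.
move=> ResP fb; pose C : {rmorphism R -> {mpoly R[n]}} := @mpolyC n R.
pose X : 'cV[{mpoly R[n]}]_n := \col_i 'X_i.
have chart k : exists A : {ffun 'I_n -> {mpoly R[n]}},
    \sum_i A i * hform_eval C (f i) (\col_i chart_var R k i) = 1.
  have [|A hA] := @chart_certificate n d Res k ResP R f b fb _ C (\col_i chart_var R k i).
    by rewrite mxE /chart_var eqxx.
  by exists (finfun A); rewrite -[RHS]hA; apply: eq_bigr => i _; rewrite ffunE.
have [A hA] := fin_all_exists chart.
(* One degree bound for all charts and all coefficients, so that the exponent [D + d] does not
   depend on [k]. *)
pose D := (\max_k \max_i msize (A k i))%N.
have szA k i : (msize (A k i) <= D.+1)%N.
  apply: leqW; apply: leq_trans (leq_bigmax k); exact: (leq_bigmax i).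
pose a k i := homogenize k D (A k i).
have haD k i : a k i \is D.-homog by apply: homogenize_homog.
have dC k r : dehomog k (C r) = C r by rewrite /dehomog /C pevC.
have dF k i x : dehomog k (hform_eval C (f i) x) = hform_eval C (f i) (map_mx (dehomog k) x).
  by apply: (@rmorph_hform_eval _ _ _ _ _ C C (dehomog k)) => r; exact: dC.
have dM k p q : dehomog k (p * q) = dehomog k p * dehomog k q by exact: rmorphM.
have dS k (G : 'I_n -> {mpoly R[n]}) : dehomog k (\sum_i G i) = \sum_i dehomog k (G i).
  exact: rmorph_sum.
have d1 k : dehomog k 1 = 1 :> {mpoly R[n]} by exact: rmorph1.
have dFX k i : dehomog k (hform_eval C (f i) X) = hform_eval C (f i) (\col_i chart_var R k i).
  by rewrite dF; congr hform_eval; apply/matrixP => j z; rewrite !mxE /dehomog pevX.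
have dFv k i : dehomog k (hform_eval C (f i) (\col_i chart_var R k i)) =
    hform_eval C (f i) (\col_i chart_var R k i).
  by rewrite dF; congr hform_eval; apply/matrixP => j z; rewrite !mxE dehomog_chart.
have da k i : dehomog k (a k i) = dehomog k (A k i) by exact: dehomog_homogenize.
have hF i : hform_eval C (f i) X \is d.-homog.
  apply: hform_eval_homog1 => [r|j]; first exact: mpolyC_homog.
  by rewrite mxE dhomogX /= mdeg1.
have E k : 'X_k ^+ (D + d) = \sum_i a k i * hform_eval C (f i) X.
  apply/eqP; rewrite -subr_eq0; apply/eqP; apply: (@dehomog_eq0 _ _ k (D + d)).
    apply: rpredB; last by apply: rpred_sum => i _; apply: dhomogM.
    by rewrite mpolyXn dhomogX /= mdegMn mdeg1 mul1n.
  rewrite rmorphB rmorphXn /= {1}/dehomog pevX /chart_var eqxx expr1n.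
  apply/eqP; rewrite subr_eq0 eq_sym dS; apply/eqP.
  rewrite -[RHS](d1 k) -[in RHS](hA k) [RHS]dS.
  by apply: eq_bigr => i _; rewrite [LHS]dM [RHS]dM da dFX dFv.
exists D, (fun k i (m : monomial n D) => (a k i)@_(val m)) => T phi x k.
have := congr1 (pev phi (fun i => x i 0)) (E k).
rewrite rmorphXn /= pevX => ->; rewrite rmorph_sum; apply: eq_bigr => i _.
rewrite rmorphM /= (pev_homog _ _ (haD k i)); congr (_ * _).
rewrite (@rmorph_hform_eval _ _ _ _ _ C phi (pev phi (fun i => x i 0))) ?pevC //.
  by congr hform_eval; apply/matrixP => j z; rewrite !mxE /= pevX ord1.
by move=> r; rewrite /C /= pevC.
Qed.

(** * Submodules *)

Lemma same_setE (V : Type) (L L' : V -> Prop) : same_set L L' -> L = L'.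
Proof.
by move=> e; apply: functional_extensionality => v; apply: propositional_extensionality.
Qed.

Section Submodules.

Variables (S : comPzRingType) (V : lmodType S).
Implicit Types (L : V -> Prop) (P : V -> Prop).

Lemma submod0 L : submodule L -> L 0. Proof. by case. Qed.

Lemma submodZ L a v : submodule L -> L v -> L (a *: v).
Proof. by case=> L0 LD Lv; rewrite -[_ *: _]addr0; apply: LD. Qed.

Lemma submodD L u v : submodule L -> L u -> L v -> L (u + v).
Proof. by case=> L0 LD Lu Lv; rewrite -[u]scale1r; apply: LD. Qed.

Lemma submod_sum L (J : Type) (r : seq J) (Q : pred J) (F : J -> V) :
  submodule L -> (forall i, Q i -> L (F i)) -> L (\sum_(i <- r | Q i) F i).
Proof.
by move=> sL LF; elim/big_ind: _ => // [|u v]; [exact: submod0 | exact: submodD].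
Qed.

Lemma modspanP P : submodule (modspan P).
Proof.
split; first by exists 0%N, (fun=> 0), (fun=> 0); split; [case | rewrite big_ord0].
move=> a u v [r [b [w [Pw ->]]]] [r' [b' [w' [Pw' ->]]]].
exists (r + r')%N, (fun i => match split i with inl j => a * b j | inr j => b' j end),
  (fun i => match split i with inl j => w j | inr j => w' j end).
split=> [i|]; first by case: split.
rewrite big_split_ord scaler_sumr; congr (_ + _); apply: eq_bigr => i _.
  by rewrite -[lshift _ _]/(unsplit (inl i)) unsplitK scalerA.
by rewrite -[rshift _ _]/(unsplit (inr i)) unsplitK.
Qed.

Lemma mem_modspan P v : P v -> modspan P v.
Proof.
move=> Pv; exists 1%N, (fun=> 1), (fun=> v); split=> //.
by rewrite big_ord1 scale1r.
Qed.

Lemma modspan_sub P L : submodule L -> (forall v, P v -> L v) ->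
  forall v, modspan P v -> L v.
Proof.
move=> sL PL _ [r [b [w [Pw ->]]]]; apply: submod_sum => // i _.
by apply: submodZ => //; apply: PL.
Qed.

Lemma submod_zero : submodule (fun v : V => v = 0).
Proof. by split=> // a u v -> ->; rewrite scaler0 addr0. Qed.

End Submodules.

Lemma submod_preim (S : comPzRingType) (V W : lmodType S) (L : W -> Prop)
    (h : {linear V -> W}) : submodule L -> submodule (fun v => L (h v)).
Proof.
move=> [L0 LD]; split; first by rewrite linear0.
by move=> a u v Lu Lv; rewrite linearP; apply: LD.
Qed.

(** * Checking membership and equality on a cover by basic opens *)

Section LocalPrinciple.

Variables (S : comPzRingType) (r : nat) (s c : 'I_r -> S).
Hypothesis cs1 : \sum_(k < r) c k * s k = 1.

Lemma radical_add (J : S -> Prop) : is_ideal J ->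
  forall x y e e', J (x ^+ e) -> J (y ^+ e') -> J ((x + y) ^+ (e + e')).
Proof.
move=> idJ x y e e' Jx Jy; rewrite exprDn; apply: ideal_sum => // i _.
rewrite -mulr_natl; apply: idealM => //; have [le_e'i|lt_ie'] := leqP e' i.
  by rewrite -(subnK le_e'i) [y ^+ _]exprD mulrA; apply: idealM.
have le_e : (e <= e + e' - i)%N by rewrite -addnBA ?leq_addr // ltnW.
by rewrite -(subnK le_e) [x ^+ _]exprD mulrAC; apply: idealM.
Qed.

(** The radical of [J] is closed under sums, hence contains \sum_k c_k s_k = 1. *)
Lemma ideal_local (J : S -> Prop) : is_ideal J ->
  (forall k, exists e, J (s k ^+ e)) -> J 1.
Proof.
move=> idJ Js; suff [e] : exists e, J ((\sum_(k < r) c k * s k) ^+ e).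
  by rewrite cs1 expr1n.
elim/big_ind: _ => [|x y [e Jx] [e' Jy]|k _]; first by exists 1%N; apply: ideal0.
  by exists (e + e')%N; apply: radical_add.
by have [e Je] := Js k; exists e; rewrite exprMn; apply: idealM.
Qed.

(** This is [ideal_local] for the ideal of all [x] with [x *: v] in [L]. *)
Lemma submod_local (V : lmodType S) (L : V -> Prop) (v : V) : submodule L ->
  (forall k, exists e, L (s k ^+ e *: v)) -> L v.
Proof.
move=> sL Ls; rewrite -[v]scale1r; apply: (ideal_local (J := fun x => L (x *: v))) => //.
split; first by rewrite scale0r; apply: submod0.
move=> a x y Lx Ly; rewrite scalerDl -scalerA; apply: submodD => //.
exact: submodZ.
Qed.

Lemma local_eq0 (V : lmodType S) (v : V) :
  (forall k, exists e, s k ^+ e *: v = 0) -> v = 0.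
Proof. exact: (submod_local (submod_zero V)). Qed.

Lemma local_eq (x y : S) :
  (forall k, exists e, s k ^+ e * x = s k ^+ e * y) -> x = y.
Proof.
move=> exy; apply/eqP; rewrite -subr_eq0; apply/eqP.
apply: (@local_eq0 S^o) => k; have [e ee] := exy k; exists e.
by rewrite /GRing.scale /= mulrBr ee subrr.
Qed.

Lemma unimodular_pow (e : 'I_r -> nat) :
  exists d : 'I_r -> S, \sum_(k < r) d k * s k ^+ e k = 1.
Proof.
suff [d ->] : exists d : 'I_r -> S, 1 = \sum_(k < r) d k * s k ^+ e k by exists d.
apply: (ideal_local (J := fun x => exists d : 'I_r -> S, x = \sum_k d k * s k ^+ e k)).
  split; first by exists (fun=> 0); rewrite big1 // => k _; rewrite mul0r.
  move=> a _ _ [d ->] [d' ->]; exists (fun k => a * d k + d' k).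
  rewrite /GRing.scale /= mulr_sumr -big_split; apply: eq_bigr => k _ /=; ring.
move=> k; exists (e k), (fun j => (j == k)%:R).
by rewrite (bigD1 k) //= eqxx mul1r big1 ?addr0 // => j /negPf->; rewrite mul0r.
Qed.

End LocalPrinciple.

(** * Coordinates on the projective linear group *)

(* The class of g is given by the tensor p (i, j) (k, l) = g_ij (g^-1)_kl; the  *)
(* relations say that p has rank one and that g g^-1 = g^-1 g = 1.              *)
Record pgl_coords (T : comPzRingType) (n : nat)
    (p : 'I_n * 'I_n -> 'I_n * 'I_n -> T) : Prop := PglCoords {
  pgl_rank1 : forall a b c d, p a b * p c d = p a d * p c b;
  pgl_invR : forall i l, \sum_j p (i, j) (j, l) = (i == l)%:R;
  pgl_invL : forall k j, \sum_i p (i, j) (k, i) = (k == j)%:R }.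

Definition coord_mx (T : comPzRingType) (n : nat)
    (p : 'I_n * 'I_n -> 'I_n * 'I_n -> T) (b : 'I_n * 'I_n) : 'M[T]_n :=
  \matrix_(i, j) p (i, j) b.

Definition coord_tr (T : comPzRingType) (n : nat)
    (p : 'I_n * 'I_n -> 'I_n * 'I_n -> T) := fun a b => p b a.

Definition coord_line (T : comPzRingType) (n : nat)
    (p : 'I_n * 'I_n -> 'I_n * 'I_n -> T) : 'M[T]_n -> Prop :=
  modspan (fun M => exists b, M = coord_mx p b).

Section Coords.

Variables (T : comPzRingType) (n : nat).
Implicit Types p q : 'I_n * 'I_n -> 'I_n * 'I_n -> T.

Lemma pgl_coords_tr p : pgl_coords p -> pgl_coords (coord_tr p).
Proof.
case=> r1 iR iL; split=> [a b c d|i l|k j]; rewrite /coord_tr.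
- by rewrite mulrC r1 mulrC.
- by rewrite iL.
- by rewrite iR eq_sym.
Qed.

Lemma coord_lineP p : submodule (coord_line p). Proof. exact: modspanP. Qed.

Lemma mem_coord_line p b : coord_line p (coord_mx p b).
Proof. by apply: mem_modspan; exists b. Qed.

Lemma coord_line_sub p (L : 'M[T]_n -> Prop) : submodule L ->
  (forall b, L (coord_mx p b)) -> forall M, coord_line p M -> L M.
Proof. by move=> sL LG; apply: modspan_sub => // M [b ->]. Qed.

Lemma coord_mulVmx p a b : pgl_coords p ->
  coord_mx (coord_tr p) a *m coord_mx p b = (p a b)%:M.
Proof.
move=> pc; apply/matrixP => x y; rewrite !mxE.
under eq_bigr do rewrite !mxE /coord_tr (pgl_rank1 pc).
by rewrite -mulr_sumr (pgl_invL pc) mulr_natr.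
Qed.

Lemma coord_mulmxV p a b : pgl_coords p ->
  coord_mx p b *m coord_mx (coord_tr p) a = (p a b)%:M.
Proof. by move/pgl_coords_tr/(coord_mulVmx b a). Qed.

Lemma coord_mxZ p a b c : pgl_coords p ->
  p a c *: coord_mx p b = p a b *: coord_mx p c.
Proof.
move=> pc; apply/matrixP => x y; rewrite !mxE.
by rewrite (pgl_rank1 pc) mulrC [RHS]mulrC mulrC.
Qed.

Lemma coord_lineZ p a c M : pgl_coords p -> coord_line p M ->
  exists k, p a c *: M = k *: coord_mx p c.
Proof.
move=> pc; apply: (coord_line_sub (L := fun M => exists k, p a c *: M = k *: coord_mx p c)).
  split; first by exists 0; rewrite scaler0 scale0r.
  move=> b u v [k ek] [k' ek']; exists (b * k + k').
  by rewrite scalerDr scalerA mulrC -scalerA ek ek' scalerDl scalerA.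
by move=> b; exists (p a b); apply: coord_mxZ.
Qed.

End Coords.

Lemma pgl_oneP (T : comPzRingType) (n : nat) : submodule (@pgl_one T n).
Proof.
split; first by exists 0; rewrite raddf0.
by move=> a _ _ [x ->] [y ->]; exists (a * x + y); rewrite raddfD /= scale_scalar_mx.
Qed.

Section CoordLocal.

Variables (T : comPzRingType) (N : nat).
Implicit Types p q : 'I_N.+1 * 'I_N.+1 -> 'I_N.+1 * 'I_N.+1 -> T.

Definition coord_den p (j : 'I_N.+1) : T := p (0, j) (j, 0).

Lemma coord_den_sum p : pgl_coords p -> \sum_j 1 * coord_den p j = 1.
Proof. by move=> pc; under eq_bigr do rewrite mul1r; rewrite (pgl_invR pc). Qed.

Lemma coord_denM p j a b : pgl_coords p ->
  coord_den p j * p a b = p a (j, 0) * p (0, j) b.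
Proof. by move=> pc; rewrite (pgl_rank1 pc) mulrC. Qed.

Lemma coord_line_pgl_point p : pgl_coords p -> pgl_point (coord_line p).
Proof.
move=> pc; split; first exact: coord_lineP.
exists N.+1, (coord_den p), (fun=> 1), (fun j => coord_mx p (j, 0)).
split=> [|j]; first exact: coord_den_sum.
split; first split; first exact: mem_coord_line.
  by move=> M /(coord_lineZ (0, j) (j, 0) pc)[k ek]; exists 1%N, k; rewrite expr1.
exists N.+1, (\det (coord_mx (coord_tr p) (0, j))).
by rewrite -det_mulmx coord_mulVmx // det_scalar.
Qed.

(** The products [coord_mx p (j, 0) *m coord_mx (coord_tr p) (0, j)] sum to the identity. So if [M]
    times each generator is scalar, then [M] is a combination of the second factors. *)
Lemma pgl_inv_line p : pgl_coords p ->
  pgl_inv (coord_line p) = coord_line (coord_tr p).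
Proof.
move=> pc; apply: same_setE => M; split=> [iM|].
  have one : \sum_j coord_mx p (j, 0) *m coord_mx (coord_tr p) (0, j) = 1%:M.
    under eq_bigr do rewrite coord_mulmxV //.
    by rewrite -raddf_sum /= (pgl_invR pc).
  rewrite -[M]mulmx1 -one mulmx_sumr; apply: submod_sum => [|j _]; first exact: coord_lineP.
  have [k ek] := iM _ (mem_coord_line p (j, 0)); rewrite mulmxA ek mul_scalar_mx.
  by apply: submodZ (coord_lineP _) _; apply: mem_coord_line.
have sone := pgl_oneP T N.+1.
move=> pM g; move: g; apply: coord_line_sub; first exact: (submod_preim (mulmx M)).
move=> b; move: M pM; apply: coord_line_sub.
  exact: (submod_preim (mulmxr (coord_mx p b))).
by move=> a; exists (p a b); rewrite coord_mulVmx.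
Qed.

(** The columns of p lie in the line of q, so the mixed minors [r1] vanish. Contracting p (x) q by
    the inverse relation of q gives p; after exchanging indices by [r1], contracting by that of p
    gives q. *)
Lemma coord_line_inj p q : pgl_coords p -> pgl_coords q ->
  coord_line p = coord_line q -> p = q.
Proof.
move=> pc qc epq.
have r1 a b c d : p a b * q c d = p c b * q a d.
  have : coord_line q (coord_mx p b) by rewrite -epq; apply: mem_coord_line.
  move=> [r [k [w [hw /matrixP ew]]]].
  have pb x : p x b = \sum_(i < r) k i * w i x.1 x.2.
    by case: x => x y; move: (ew x y); rewrite mxE summxE => ->; apply: eq_bigr => i _; rewrite mxE.
  rewrite !pb !mulr_suml; apply: eq_bigr => i _; have [e ->] := hw i.
  rewrite !mxE -!mulrA; congr (_ * _).
  by rewrite -!surjective_pairing (pgl_rank1 qc) mulrC.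
apply: functional_extensionality => -[i j]; apply: functional_extensionality => -[k l].
transitivity (\sum_x \sum_y p (i, j) (k, x) * q (x, y) (y, l)).
  rewrite (bigD1 l) //= [X in _ + X]big1 ?addr0 => [|x xl].
    by rewrite -mulr_sumr (pgl_invR qc) eqxx mulr1.
  by rewrite -mulr_sumr (pgl_invR qc) (negPf xl) mulr0.
under eq_bigr do under eq_bigr do rewrite r1.
rewrite exchange_big /= (bigD1 k) //= [X in _ + X]big1 ?addr0 => [|x xk].
  by rewrite -mulr_suml (pgl_invL pc) eqxx mul1r.
by rewrite -mulr_suml (pgl_invL pc) eq_sym (negPf xk) mul0r.
Qed.

(** Over each D(s_k) the tensor is g_k (x) adj(g_k) / det(g_k). A partition of unity by powers of
    the s_k clears the denominators and glues. The rank one relation comes from [rk]: elements of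
    [L] are locally proportional, so their minors vanish. *)
Lemma pgl_point_coords (L : 'M[T]_N.+1 -> Prop) : pgl_point L ->
  exists2 p, pgl_coords p & L = coord_line p.
Proof.
case=> sL [r [s [c [g [cs1 gP]]]]].
have rk u v a b : L u -> L v -> u a.1 a.2 * v b.1 b.2 = v a.1 a.2 * u b.1 b.2.
  move=> Lu Lv; apply: (local_eq cs1) => k.
  have [[_ gk] _] := gP k; have [e [x ex]] := gk u Lu; have [e' [y ey]] := gk v Lv.
  exists (e + e')%N; rewrite exprD.
  have exE i j : s k ^+ e * u i j = x * g k i j by move/matrixP/(_ i j): ex; rewrite !mxE.
  have eyE i j : s k ^+ e' * v i j = y * g k i j by move/matrixP/(_ i j): ey; rewrite !mxE.
  by rewrite mulrACA exE eyE [v _ _ * u _ _]mulrC [RHS]mulrACA exE eyE; ring.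
have [e he] := fin_all_exists (fun k => (gP k).2).
have [x hx] := fin_all_exists he.
have [d d1] := unimodular_pow cs1 e.
pose m k := (d k * x k) *: \adj (g k).
have mg k : m k *m g k = (d k * s k ^+ e k)%:M.
  by rewrite -scalemxAl mul_adj_mx scale_scalar_mx -mulrA hx.
have gm k : g k *m m k = (d k * s k ^+ e k)%:M.
  by rewrite -scalemxAr mul_mx_adj scale_scalar_mx -mulrA hx.
pose p (a b : 'I_N.+1 * 'I_N.+1) := \sum_k g k a.1 a.2 * m k b.1 b.2.
have Lg k : L (g k) by case: (gP k) => -[].
have iL k j : \sum_i p (i, j) (k, i) = (k == j)%:R.
  rewrite exchange_big /=; transitivity ((\sum_i m i *m g i) k j).
    by rewrite summxE; apply: eq_bigr => i _; rewrite mxE; apply: eq_bigr => l _; rewrite mulrC.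
  by under eq_bigr do rewrite mg; rewrite -raddf_sum d1 !mxE.
exists p.
  split=> // [a b a' b'|i l].
    rewrite !mulr_suml; under eq_bigr do rewrite mulr_sumr.
    under [RHS]eq_bigr do rewrite mulr_sumr.
    rewrite [RHS]exchange_big; apply: eq_bigr => i _; apply: eq_bigr => j _ /=.
    by rewrite mulrACA (rk (g i) (g j) a a') //; ring.
  rewrite exchange_big /=; transitivity ((\sum_k g k *m m k) i l).
    by rewrite summxE; apply: eq_bigr => k _; rewrite mxE.
  by under eq_bigr do rewrite gm; rewrite -raddf_sum d1 !mxE.
apply: same_setE => w; split=> [Lw|]; last first.
  apply: coord_line_sub => // b.
  have -> : coord_mx p b = \sum_k m k b.1 b.2 *: g k.
    apply/matrixP => i j; rewrite [LHS]mxE summxE; apply: eq_bigr => k _.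
    by rewrite [RHS]mxE mulrC.
  by apply: submod_sum => // k _; apply: submodZ.
(* By [rk], w_y0 p(ij, 0y) equals w_ij p(y0, 0y), and p(y0, 0y) sums to 1 over y. *)
have -> : w = \sum_y w y 0 *: coord_mx p (0, y).
  apply/matrixP => i j; rewrite summxE.
  rewrite (eq_bigr (fun y => w y 0 * p (i, j) (0, y))) => [|y _]; last first.
    by rewrite mxE [X in _ * X]mxE.
  transitivity (w i j * \sum_i0 p (i0, 0) (0, i0)); first by rewrite iL eqxx mulr1.
  rewrite mulr_sumr; apply: eq_bigr => y _.
  rewrite !mulr_sumr; apply: eq_bigr => k _ /=.
  by have := rk w (g k) (i, j) (y, 0) Lw (Lg k) => /= E; rewrite mulrA E; ring.
apply: submod_sum (coord_lineP _) _ => y _; apply: submodZ (coord_lineP _) _.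
exact: mem_coord_line.
Qed.

End CoordLocal.

Lemma pgl_coords_map (S T : comPzRingType) (h : {rmorphism S -> T}) (n : nat)
    (p : 'I_n * 'I_n -> 'I_n * 'I_n -> S) :
  pgl_coords p -> pgl_coords (fun a b => h (p a b)).
Proof.
move=> pc; split=> [a b c d|i l|k j]; first by rewrite -!rmorphM (pgl_rank1 pc).
  by rewrite -rmorph_sum (pgl_invR pc) rmorph_nat.
by rewrite -rmorph_sum (pgl_invL pc) rmorph_nat.
Qed.

Lemma map_coord_mx (S T : comPzRingType) (h : {rmorphism S -> T}) (n : nat)
    (p : 'I_n * 'I_n -> 'I_n * 'I_n -> S) b :
  map_mx h (coord_mx p b) = coord_mx (fun a b => h (p a b)) b.
Proof. by apply/matrixP => i j; rewrite !mxE. Qed.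

Lemma pgl_base_line (S T : comPzRingType) (h : {rmorphism S -> T}) (n : nat)
    (p : 'I_n * 'I_n -> 'I_n * 'I_n -> S) :
  pgl_base h (coord_line p) = coord_line (fun a b => h (p a b)).
Proof.
apply: same_setE => M; split.
  apply: modspan_sub; first exact: coord_lineP.
  move=> _ [M' [r [k [w [hw ->]]]] ->]; rewrite raddf_sum.
  apply: submod_sum (coord_lineP _) _ => i _; rewrite /= map_mxZ.
  apply: submodZ (coord_lineP _) _; have [b ->] := hw i.
  by rewrite map_coord_mx; apply: mem_coord_line.
apply: coord_line_sub; first exact: modspanP.
move=> b; apply: mem_modspan; exists (coord_mx p b); first exact: mem_coord_line.
by rewrite map_coord_mx.
Qed.

(** * The group law on tensors *)

Section CoordGroup.

Variables (T : comPzRingType) (n : nat).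
Implicit Types p q : 'I_n * 'I_n -> 'I_n * 'I_n -> T.

Definition coord_one : 'I_n * 'I_n -> 'I_n * 'I_n -> T :=
  fun a b => (a.1 == a.2)%:R * (b.1 == b.2)%:R.

(** The expansion of (gh)_ij ((gh)^-1)_kl for p = g (x) g^-1 and q = h (x) h^-1. *)
Definition coord_mul p q : 'I_n * 'I_n -> 'I_n * 'I_n -> T :=
  fun a b => \sum_x \sum_y p (a.1, x) (y, b.2) * q (x, a.2) (b.1, y).

Lemma sum_delta (i : 'I_n) (G : 'I_n -> T) : \sum_j (i == j)%:R * G j = G i.
Proof.
rewrite (bigD1 i) //= eqxx mul1r big1 ?addr0 // => j /negPf ji.
by rewrite eq_sym ji mul0r.
Qed.

Lemma pgl_coords_one : pgl_coords coord_one.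
Proof.
split=> [a b c d|i l|k j]; rewrite /coord_one /=; first by ring.
  by rewrite sum_delta.
by under eq_bigr do rewrite mulrC; rewrite sum_delta.
Qed.

Lemma coord_mx_one b : coord_mx coord_one b = (b.1 == b.2)%:R *: 1%:M.
Proof. by apply/matrixP => i j; rewrite !mxE mulrC. Qed.

Lemma coord_tr_one : coord_tr coord_one = coord_one.
Proof.
by apply: functional_extensionality => b; apply: functional_extensionality => c;
  apply: mulrC.
Qed.

Lemma pgl_coords_mul p q : pgl_coords p -> pgl_coords q -> pgl_coords (coord_mul p q).
Proof.
move=> pc qc; split=> [[a1 a2] [b1 b2] [c1 c2] [d1 d2]|i l|k j];
  rewrite /coord_mul /=.
- rewrite !mulr_suml; apply: eq_bigr => x _; rewrite !mulr_sumr; apply: eq_bigr => x' _.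
  rewrite !big_distrlr /= [RHS]exchange_big; apply: eq_bigr => y _; apply: eq_bigr => y' _ /=.
  by rewrite mulrACA (pgl_rank1 pc) (pgl_rank1 qc); ring.
- transitivity (\sum_x \sum_y p (i, x) (y, l) * (x == y)%:R).
    rewrite exchange_big /=; apply: eq_bigr => x _; rewrite exchange_big /=.
    by apply: eq_bigr => y _; rewrite -mulr_sumr (pgl_invR qc).
  rewrite -(pgl_invR pc); apply: eq_bigr => x _.
  by under eq_bigr do rewrite mulrC; rewrite sum_delta.
- transitivity (\sum_x \sum_y (y == x)%:R * q (x, j) (k, y)).
    rewrite exchange_big /=; apply: eq_bigr => x _; rewrite exchange_big /=.
    by apply: eq_bigr => y _; rewrite -mulr_suml (pgl_invL pc).
  rewrite -(pgl_invL qc); apply: eq_bigr => x _.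
  by under eq_bigr do rewrite eq_sym; rewrite sum_delta.
Qed.

Lemma coord_mx_mul p q b :
  coord_mx (coord_mul p q) b = \sum_y coord_mx p (y, b.2) *m coord_mx q (b.1, y).
Proof.
apply/matrixP => i j; rewrite mxE summxE /coord_mul exchange_big /=.
apply: eq_bigr => y _; rewrite mxE; apply: eq_bigr => x _; by rewrite !mxE.
Qed.

Lemma coord_tr_mul p q : coord_tr (coord_mul p q) = coord_mul (coord_tr q) (coord_tr p).
Proof.
apply: functional_extensionality => b; apply: functional_extensionality => c.
rewrite /coord_tr /coord_mul exchange_big; apply: eq_bigr => x _; apply: eq_bigr => y _.
exact: mulrC.
Qed.

Lemma coord_line_mul p q : pgl_coords p -> pgl_coords q ->
  pgl_mul (coord_line p) (coord_line q) = coord_line (coord_mul p q).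
Proof.
move=> pc qc; apply: same_setE => M; split.
  apply: modspan_sub; first exact: coord_lineP.
  move=> _ [g [g' [pg qg' ->]]]; move: g' qg'; apply: coord_line_sub.
    exact: (submod_preim (mulmx g) (coord_lineP _)).
  move=> [u v]; move: g pg; apply: coord_line_sub.
    exact: (submod_preim (mulmxr (coord_mx q (u, v))) (coord_lineP _)).
  move=> [k l] /=.
  (* By [coord_mxZ], q(kx, uv) times the column (x, y) of q is q(kx, xy) times the column (u, v);
     summing over x leaves only y = k. *)
  have -> : coord_mx p (k, l) *m coord_mx q (u, v) =
      \sum_x q (k, x) (u, v) *: coord_mx (coord_mul p q) (x, l).
    under eq_bigr do rewrite coord_mx_mul scaler_sumr /=.
    rewrite exchange_big /=.
    rewrite (eq_bigr (fun y => (k == y)%:R *: (coord_mx p (y, l) *m coord_mx q (u, v)))).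
      rewrite (bigD1 k) //= eqxx scale1r big1 ?addr0 // => y /negPf yk.
      by rewrite eq_sym yk scale0r.
    move=> y _; rewrite -(pgl_invR qc) scaler_suml; apply: eq_bigr => x _.
    by rewrite !scalemxAr (coord_mxZ (k, x) (x, y) (u, v) qc).
  apply: submod_sum (coord_lineP _) _ => x _; apply: submodZ (coord_lineP _) _.
  exact: mem_coord_line.
apply: coord_line_sub; first exact: modspanP.
move=> b; rewrite coord_mx_mul; apply: submod_sum (modspanP _) _ => y _.
apply: mem_modspan; exists (coord_mx p (y, b.2)), (coord_mx q (b.1, y)).
by split=> //; apply: mem_coord_line.
Qed.

End CoordGroup.

Lemma coord_line_one (T : comPzRingType) (N : nat) :
  coord_line (@coord_one T N.+1) = @pgl_one T N.+1.
Proof.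
apply: same_setE => M; split.
  apply: coord_line_sub; first exact: pgl_oneP.
  by move=> b; exists (b.1 == b.2)%:R; rewrite coord_mx_one scale_scalar_mx mulr1.
case=> c ->; rewrite -[c]mulr1 -scale_scalar_mx; apply: submodZ (coord_lineP _) _.
have -> : 1%:M = coord_mx (@coord_one T N.+1) (0, 0) by rewrite coord_mx_one eqxx scale1r.
exact: mem_coord_line.
Qed.

(** * Equivariance in coordinates *)

Section Forms.

Variables (R : comPzRingType) (n d : nat) (f : 'I_n -> hform R n d).

Definition forms_eval (T : comPzRingType) (phi : {rmorphism R -> T}) (x : 'cV[T]_n) :
    'cV[T]_n := \col_i hform_eval phi (f i) x.

Lemma forms_evalZ (T : comPzRingType) (phi : {rmorphism R -> T}) c x :
  forms_eval phi (c *: x) = c ^+ d *: forms_eval phi x.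
Proof. by apply/matrixP => i j; rewrite !mxE hform_evalZ. Qed.

Lemma map_forms_eval (T T' : comPzRingType) (phi : {rmorphism R -> T})
    (psi : {rmorphism R -> T'}) (h : {rmorphism T -> T'}) x :
  (forall r, h (phi r) = psi r) ->
  map_mx h (forms_eval phi x) = forms_eval psi (map_mx h x).
Proof. by move=> e; apply/matrixP => i j; rewrite !mxE (rmorph_hform_eval _ _ e). Qed.

Lemma eq_forms_eval (T : comPzRingType) (phi psi : {rmorphism R -> T}) x :
  phi =1 psi -> forms_eval phi x = forms_eval psi x.
Proof. by move=> e; apply/matrixP => i j; rewrite !mxE (eq_hform_eval _ _ e). Qed.

End Forms.

Section Equivariance.

Variables (R : comPzRingType) (N d D : nat) (f : 'I_N.+1 -> hform R N.+1 d).
Variable a : 'I_N.+1 -> 'I_N.+1 -> hform R N.+1 D.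
Local Notation n := N.+1.
Hypothesis cert : forall (T : comPzRingType) (phi : {rmorphism R -> T})
  (x : 'cV[T]_n) (k : 'I_n),
  x k 0 ^+ (D + d) = \sum_i hform_eval phi (a k i) x * hform_eval phi (f i) x.

Local Notation coords T := ('I_n * 'I_n -> 'I_n * 'I_n -> T).
Local Notation F := (forms_eval f).

Section AtRing.

Variables (T : comPzRingType) (phi : {rmorphism R -> T}).

Let e0 : 'cV[T]_n := delta_mx 0 0.

(* If g f(m x) = c f(x) for all x, then c is the following number. *)
Definition factor (g m : 'M[T]_n) : T :=
  \sum_t hform_eval phi (a 0 t) e0 * (g *m F phi (m *m e0)) t 0.

Lemma pairing_e0 c : \sum_t hform_eval phi (a 0 t) e0 * (c *: F phi e0) t 0 = c.
Proof.
rewrite -[RHS]mulr1 (_ : 1 = e0 0 0 ^+ (D + d)); last by rewrite mxE !eqxx expr1n.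
rewrite (cert phi) mulr_sumr; apply: eq_bigr => t _; rewrite !mxE; ring.
Qed.

Lemma factor_unique g m c :
  (forall x, g *m F phi (m *m x) = c *: F phi x) -> factor g m = c.
Proof. by move=> e; rewrite /factor e pairing_e0. Qed.

Lemma mulmx_formsZ (g m : 'M[T]_n) u w x :
  (u *: g) *m F phi ((w *: m) *m x) = (u * w ^+ d) *: (g *m F phi (m *m x)).
Proof. by rewrite -scalemxAl -scalemxAl forms_evalZ -scalemxAr scalerA. Qed.

Lemma factorZ (g m : 'M[T]_n) u w : factor (u *: g) (w *: m) = u * w ^+ d * factor g m.
Proof.
rewrite /factor mulmx_formsZ mulr_sumr; apply: eq_bigr => t _.
by rewrite [X in _ * X]mxE; ring.
Qed.

(** Naming the scalar by [factor] replaces an existential by an equation in p. All pairs of columns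
    are required because no single column need generate the line. *)
Definition equiv_at (p : coords T) : Prop := forall b c x,
  coord_mx p c *m F phi (coord_mx (coord_tr p) b *m x) =
  factor (coord_mx p c) (coord_mx (coord_tr p) b) *: F phi x.

Section Local.

Variables (p : coords T) (pc : pgl_coords p) (ep : equiv_at p) (j : 'I_n).
Let g := coord_mx p (j, 0).
Let m := coord_mx (coord_tr p) (0, j).
Let s := coord_den p j.

Lemma local_mulV : m *m g = s%:M. Proof. exact: coord_mulVmx. Qed.
Lemma local_mulmV : g *m m = s%:M. Proof. exact: coord_mulmxV. Qed.

Lemma local_coord b : s *: coord_mx p b = p (0, j) b *: g.
Proof. exact: coord_mxZ. Qed.

Lemma local_coord_tr b : s *: coord_mx (coord_tr p) b = p b (j, 0) *: m.
Proof. exact: (coord_mxZ (j, 0) b (0, j) (pgl_coords_tr pc)). Qed.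

Lemma local_equiv x : g *m F phi (m *m x) = factor g m *: F phi x.
Proof. exact: ep. Qed.

Lemma local_equiv_m y : s *: F phi (m *m y) = factor g m *: (m *m F phi y).
Proof. by rewrite -mul_scalar_mx -local_mulV -mulmxA local_equiv scalemxAr. Qed.

(** Equivariance at [g *m x], multiplied by [m]: as m g = s, the argument contributes s^d and the
    outer product one more s. *)
Let sub_g x : s ^+ d.+1 *: F phi x = factor g m *: (m *m F phi (g *m x)).
Proof.
rewrite scalemxAr -local_equiv mulmxA local_mulV mulmxA local_mulV !mul_scalar_mx.
by rewrite forms_evalZ scalerA -exprS.
Qed.

(** Both sides are read off [sub_g] at the base vector by the pairing that isolates the scalar. *)
Lemma factorV : factor g m * factor m g = s ^+ d.+1.
Proof.
rewrite -[RHS]pairing_e0 sub_g /factor mulr_sumr; apply: eq_bigr => t _.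
by rewrite [X in _ = _ * X]mxE; ring.
Qed.

(** The common power of [s] stays, since [s] may be a zero divisor; it disappears on gluing over the
    cover by the [coord_den p j]. *)
Lemma local_equivV x :
  s ^+ d.+1 *: (m *m F phi (g *m x)) = s ^+ d.+1 *: (factor m g *: F phi x).
Proof.
rewrite -{1}factorV mulrC -scalerA -sub_g !scalerA.
by rewrite mulrC.
Qed.

Lemma local_equiv_g x :
  s ^+ d.+2 *: F phi (g *m x) = (s ^+ d.+1 * factor m g) *: (g *m F phi x).
Proof.
rewrite -scalerA scalemxAr scalemxAr -local_equivV -scalemxAr mulmxA local_mulmV.
by rewrite mul_scalar_mx scalerA -exprSr.
Qed.

End Local.

Lemma vec_local (p : coords T) (x y : 'cV[T]_n) : pgl_coords p ->
  (forall j, exists e, coord_den p j ^+ e *: x = coord_den p j ^+ e *: y) -> x = y.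
Proof.
move=> pc exy; apply/eqP; rewrite -subr_eq0; apply/eqP.
apply: (local_eq0 (coord_den_sum pc)) => j; have [e ee] := exy j; exists e.
by rewrite scalerBr ee subrr.
Qed.

Lemma equiv_at_tr p : pgl_coords p -> equiv_at p -> equiv_at (coord_tr p).
Proof.
move=> pc ep b c x; apply: (vec_local pc) => j.
set M := coord_mx (coord_tr p) c; set G := coord_mx _ b; set s := coord_den p j.
(* One [d.+1] rescales the outer matrix by s and the inner one by s, the latter counting d times;
   the other is the power in [local_equivV]. *)
exists (d.+1 + d.+1)%N; rewrite exprD -!scalerA.
have E y : s ^+ d.+1 *: (M *m F phi (G *m y)) = (s *: M) *m F phi ((s *: G) *m y).
  by rewrite mulmx_formsZ exprS.
have E' : s ^+ d.+1 * factor M G = factor (s *: M) (s *: G) by rewrite factorZ exprS.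
rewrite E (scalerA (s ^+ d.+1) (factor M G)) E' /M /G local_coord_tr //.
rewrite (local_coord pc j b) mulmx_formsZ factorZ [LHS]scalerA [X in X *: _ = _]mulrC -[LHS]scalerA.
by rewrite local_equivV // !scalerA; congr (_ *: _); ring.
Qed.

Lemma equiv_at_one : equiv_at (@coord_one T n).
Proof.
move=> b c x; rewrite coord_tr_one !coord_mx_one mulmx_formsZ factorZ !mul1mx.
by rewrite (@factor_unique _ _ 1) ?mulr1 // => y; rewrite !mul1mx scale1r.
Qed.

Lemma scale_mulmx (A B : 'M[T]_n) x y : (x * y) *: (A *m B) = (x *: A) *m (y *: B).
Proof. by rewrite -scalemxAl -scalemxAr scalerA. Qed.

Lemma coord_mx_mul_local (p q : coords T) j k b : pgl_coords p -> pgl_coords q ->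
  exists u, (coord_den p j * coord_den q k) *: coord_mx (coord_mul p q) b =
    u *: (coord_mx p (j, 0) *m coord_mx q (k, 0)).
Proof.
move=> pc qc; exists (\sum_y p (0, j) (y, b.2) * q (0, k) (b.1, y)).
rewrite coord_mx_mul scaler_sumr scaler_suml; apply: eq_bigr => y _.
by rewrite scale_mulmx !local_coord // -scale_mulmx.
Qed.

Lemma coord_mx_tr_mul_local (p q : coords T) j k b : pgl_coords p -> pgl_coords q ->
  exists u, (coord_den p j * coord_den q k) *: coord_mx (coord_tr (coord_mul p q)) b =
    u *: (coord_mx (coord_tr q) (0, k) *m coord_mx (coord_tr p) (0, j)).
Proof.
move=> pc qc; exists (\sum_y q (y, b.2) (k, 0) * p (b.1, y) (j, 0)).
rewrite coord_tr_mul coord_mx_mul scaler_sumr scaler_suml; apply: eq_bigr => y _.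
by rewrite [coord_den p j * _]mulrC [LHS]scale_mulmx !local_coord_tr // -scale_mulmx.
Qed.

Lemma equiv_at_mul p q : pgl_coords p -> pgl_coords q ->
  equiv_at p -> equiv_at q -> equiv_at (coord_mul p q).
Proof.
move=> pc qc ep eq b c x; set G := coord_mx _ c; set M := coord_mx _ b.
apply: (vec_local pc) => j; exists d.+1; apply: (vec_local qc) => k; exists d.+1.
have [u eu] := coord_mx_mul_local j k c pc qc.
have [w ew] := coord_mx_tr_mul_local j k b pc qc.
rewrite [LHS]scalerA [RHS]scalerA -exprMn mulrC.
set t := _ * _ in eu ew *.
have E : t ^+ d.+1 *: (G *m F phi (M *m x)) = (t *: G) *m F phi ((t *: M) *m x).
  by rewrite mulmx_formsZ exprS.
have E' : t ^+ d.+1 * factor G M = factor (t *: G) (t *: M) by rewrite factorZ exprS.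
rewrite E [RHS]scalerA E' eu ew mulmx_formsZ factorZ -[RHS]scalerA; congr (_ *: _).
have H y : coord_mx p (j, 0) *m coord_mx q (k, 0) *m
    F phi (coord_mx (coord_tr q) (0, k) *m coord_mx (coord_tr p) (0, j) *m y) =
    (factor (coord_mx q (k, 0)) (coord_mx (coord_tr q) (0, k)) *
     factor (coord_mx p (j, 0)) (coord_mx (coord_tr p) (0, j))) *: F phi y.
  by rewrite -!mulmxA local_equiv // -scalemxAr local_equiv // scalerA.
by rewrite H (factor_unique H).
Qed.

(** Both inclusions are checked over the D(s), where the class is an honest matrix up to scaling;
    the first one also over the opens where [L] has a generator. *)
Lemma equiv_at_conj p (L : 'cV[T]_n -> Prop) : pgl_coords p -> equiv_at p ->
  proj_point L -> same_set (proj_map_conj phi f (coord_line p) L) (proj_map phi f L).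
Proof.
move=> pc ep [sL [r [t [c [v [ct1 vP]]]]]]; rewrite /proj_map_conj pgl_inv_line //.
have cs1 := coord_den_sum pc.
split.
  apply: modspan_sub; first exact: modspanP.
  move=> _ [g' [y [pg' Wy ->]]]; move: y Wy; apply: modspan_sub.
    exact: (submod_preim (mulmx g') (modspanP _)).
  move=> _ [v' Lv' ->]; rewrite -/(forms_eval f phi v').
  apply: (submod_local cs1) (modspanP _) _ => j; exists d.+1.
  apply: (submod_local ct1) (modspanP _) _ => k.
  set s := coord_den p j; set m := coord_mx (coord_tr p) (0, j).
  have [[Lvk vk] _] := vP k.
  (* Locally the transformed line is generated by [m *m v k]. The property is stable under
     combinations, so it suffices to check it on products. *)
  have [e [ka eka]] : exists e ka, (t k ^+ e * s) *: v' = ka *: (m *m v k).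
    move: v' Lv'; apply: modspan_sub.
      split; first by exists 0%N, 0; rewrite scaler0 scale0r.
      move=> b x y [e1 [k1 h1]] [e2 [k2 h2]].
      exists (e1 + e2)%N, (b * t k ^+ e2 * k1 + t k ^+ e1 * k2).
      transitivity ((b * t k ^+ e2) *: ((t k ^+ e1 * s) *: x) +
          t k ^+ e1 *: ((t k ^+ e2 * s) *: y)).
        by rewrite scalerDr !scalerA exprD; congr (_ *: _ + _ *: _); ring.
      by rewrite h1 h2 !scalerA scalerDl.
    move=> _ [m' [x [pm' Lx ->]]].
    have [b eb] := coord_lineZ (j, 0) (0, j) (pgl_coords_tr pc) pm'.
    have [e [b' eb']] := vk x Lx.
    exists e, (b' * b); transitivity ((s *: m') *m (t k ^+ e *: x)).
      by rewrite -scalemxAl -scalemxAr scalerA mulrC.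
    by rewrite [s *: m']eb eb' -scalemxAl -scalemxAr scalerA mulrC.
  have [tau etau] := coord_lineZ (0, j) (j, 0) pc pg'.
  exists (e * d)%N.
  have -> : t k ^+ (e * d) *: (s ^+ d.+1 *: (g' *m F phi v')) =
      (tau * ka ^+ d * factor (coord_mx p (j, 0)) m) *: F phi (v k).
    transitivity ((s *: g') *m F phi ((t k ^+ e * s) *: v')).
      rewrite forms_evalZ -scalemxAl -scalemxAr !scalerA; congr (_ *: _).
      by rewrite exprMn -exprM exprS; ring.
    rewrite eka [s *: g']etau forms_evalZ -scalemxAl -scalemxAr local_equiv //.
    by rewrite !scalerA.
  by apply: submodZ (modspanP _) _; apply: mem_modspan; exists (v k).
apply: modspan_sub; first exact: modspanP.
move=> _ [v' Lv' ->]; rewrite -/(forms_eval f phi v').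
apply: (submod_local cs1) (modspanP _) _ => j; exists d.+1.
(* The power s^(d+1) is a product of two factors, one of which turns f(v') into g f(m v'). *)
rewrite -factorV // mulrC -scalerA -local_equiv //; apply: submodZ (modspanP _) _.
apply: mem_modspan; exists (coord_mx p (j, 0)), (F phi (coord_mx (coord_tr p) (0, j) *m v')).
split=> //; first exact: mem_coord_line.
apply: mem_modspan; exists (coord_mx (coord_tr p) (0, j) *m v') => //.
apply: mem_modspan; exists (coord_mx (coord_tr p) (0, j)), v'; split=> //.
exact: mem_coord_line.
Qed.

End AtRing.

(** * Automorphism tensors and the functor *)

Lemma eq_equiv_at (T : comPzRingType) (phi psi : {rmorphism R -> T}) p :
  phi =1 psi -> equiv_at phi p -> equiv_at psi p.
Proof.
move=> e ep b c x; rewrite -!(eq_forms_eval _ _ e) ep; congr (_ *: _).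
apply: eq_bigr => t _; rewrite -(eq_forms_eval _ _ e); congr (_ * _).
exact: eq_hform_eval.
Qed.

(** All base changes are included because forms are not determined by their values over a single
    ring. *)
Definition aut_coords (S : comPzRingType) (phi : {rmorphism R -> S}) (p : coords S) :=
  pgl_coords p /\ forall (T : comPzRingType) (h : {rmorphism S -> T}),
    equiv_at (h \o phi : {rmorphism R -> T}) (fun b c => h (p b c)).

Lemma aut_coords_map (S T : comPzRingType) (phi : {rmorphism R -> S})
    (psi : {rmorphism R -> T}) (h : {rmorphism S -> T}) p :
  (forall r, h (phi r) = psi r) -> aut_coords phi p ->
  aut_coords psi (fun b c => h (p b c)).
Proof.
move=> e [pc ep]; split; first exact: pgl_coords_map.
move=> T' h'; apply: eq_equiv_at (ep _ (h' \o h : {rmorphism S -> T'})) => r /=.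
by rewrite e.
Qed.

Lemma aut_coords_one (S : comPzRingType) (phi : {rmorphism R -> S}) :
  aut_coords phi (@coord_one S n).
Proof.
split=> [|T h]; first exact: pgl_coords_one.
rewrite (_ : (fun b c => h (coord_one S b c)) = @coord_one T n); first exact: equiv_at_one.
do 2![apply: functional_extensionality => ?].
by rewrite /coord_one rmorphM !rmorph_nat.
Qed.

Lemma aut_coords_mul (S : comPzRingType) (phi : {rmorphism R -> S}) p q :
  aut_coords phi p -> aut_coords phi q -> aut_coords phi (coord_mul p q).
Proof.
move=> [pc ep] [qc eq]; split=> [|T h]; first exact: pgl_coords_mul.
rewrite (_ : (fun b c => h (coord_mul p q b c)) =
    coord_mul (fun b c => h (p b c)) (fun b c => h (q b c))).
  by apply: equiv_at_mul; rewrite //; apply: pgl_coords_map.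
do 2![apply: functional_extensionality => ?]; rewrite /coord_mul rmorph_sum.
apply: eq_bigr => x _; rewrite rmorph_sum; apply: eq_bigr => y _; exact: rmorphM.
Qed.

Lemma aut_coords_tr (S : comPzRingType) (phi : {rmorphism R -> S}) p :
  aut_coords phi p -> aut_coords phi (coord_tr p).
Proof.
move=> [pc ep]; split=> [|T h]; first exact: pgl_coords_tr.
exact: equiv_at_tr (pgl_coords_map h pc) (ep T h).
Qed.

Lemma aut_coords_functor (S : comPzRingType) (phi : {rmorphism R -> S}) p :
  aut_coords phi p -> Aut_functor f phi (coord_line p).
Proof.
move=> [pc ep]; split; first exact: coord_line_pgl_point.
move=> T h L; rewrite pgl_base_line; apply: equiv_at_conj => //.
exact: pgl_coords_map.
Qed.

(** The functor is tested on the line spanned by the generic point [v] of the chart x_0 = 1 over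
    S[x], which gives proportionality there with a polynomial ratio [L]. By [proportional_forms] the
    ratio is a constant and the relation holds between forms, so it specializes to any vector. *)
Lemma functor_generic (S : comNzRingType) (phi : {rmorphism R -> S}) (p : coords S) b c :
  pgl_coords p -> Aut_functor f phi (coord_line p) ->
  exists k : S, forall (T : comPzRingType) (h : {rmorphism S -> T}) (x : 'cV[T]_n),
    map_mx h (coord_mx p c) *m
      F (h \o phi : {rmorphism R -> T}) (map_mx h (coord_mx (coord_tr p) b) *m x) =
    h k *: F (h \o phi : {rmorphism R -> T}) x.
Proof.
move=> pc [_ autP]; pose A := {mpoly S[n]}.
pose C : {rmorphism S -> A} := @mpolyC n S.
pose phiC : {rmorphism R -> A} := C \o phi.
pose G := map_mx C (coord_mx p c); pose M := map_mx C (coord_mx (coord_tr p) b).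
pose v : 'cV[A]_n := \col_i chart_var S 0 i; pose X : 'cV[A]_n := \col_i 'X_i.
have [L HL] : exists L : A, G *m F phiC (M *m v) = L *: F phiC v.
  pose line (w : 'cV[A]_n) := exists k, w = k *: v.
  have lineP : proj_point line.
    split.
      split; first by exists 0; rewrite scale0r.
      by move=> x _ _ [k ->] [k' ->]; exists (x * k + k'); rewrite scalerDl scalerA.
    exists 1%N, (fun=> 1), (fun=> 1), (fun=> v); rewrite big_ord1 mulr1; split=> // _.
    split; first split; first by exists 1; rewrite scale1r.
      by move=> _ [k ->]; exists 0%N, k; rewrite scale1r.
    exists 0%N, (fun j => (0 == j)%:R).
    by rewrite sum_delta mxE /chart_var eqxx.
  have := autP A C line lineP (G *m F phiC (M *m v)).
  rewrite pgl_base_line /proj_map_conj pgl_inv_line; last exact: pgl_coords_map.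
  case=> + _; case.
    apply: mem_modspan; exists G, (F phiC (M *m v)); split=> //.
      by rewrite /G map_coord_mx; apply: mem_coord_line.
    apply: mem_modspan; exists (M *m v) => //.
    apply: mem_modspan; exists M, v; split=> //; last by exists 1; rewrite scale1r.
    by rewrite /M map_coord_mx; apply: (mem_coord_line (coord_tr _)).
  move=> r [k [w [hw ->]]].
  suff [L HL] : exists L : 'I_r -> A, forall i, w i = L i *: F phiC v.
    exists (\sum_i k i * L i); rewrite scaler_suml; apply: eq_bigr => i _.
    by rewrite HL scalerA.
  suff /fin_all_exists[L HL] : forall i, exists L, w i = L *: F phiC v by exists L.
  by move=> i; have [_ [l ->] ->] := hw i; exists (l ^+ d); rewrite -forms_evalZ.
have hC r : C r \is 0.-homog by apply: mpolyC_homog.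
have hX i : X i 0 \is 1.-homog by rewrite mxE dhomogX /= mdeg1.
pose Fi i := F phiC X i 0; pose Hi i := (G *m F phiC (M *m X)) i 0.
have hF i : Fi i \is d.-homog.
  by rewrite /Fi mxE; apply: hform_eval_homog1 => // r; apply: hC.
have hH i : Hi i \is d.-homog.
  rewrite /Hi mxE; apply: rpred_sum => j _; apply: (@dhomogM _ _ _ 0%N _ d).
    by rewrite mxE; apply: hC.
  rewrite mxE; apply: hform_eval_homog1 => [r|l]; first exact: hC.
  rewrite mxE; apply: rpred_sum => z _; apply: (@dhomogM _ _ _ 0%N _ 1%N) => //.
  by rewrite mxE; apply: hC.
pose ai i j := hform_eval phiC (a i j) X.
have ha i j : ai i j \is D.-homog.
  by rewrite /ai; apply: hform_eval_homog1 => // r; apply: hC.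
have aF i : 'X_i ^+ (D + d) = \sum_j ai i j * Fi j.
  have := cert phiC X i; rewrite mxE => ->; apply: eq_bigr => j _.
  by rewrite /Fi mxE.
pose dh : {rmorphism A -> A} := dehomog (S := S) (n := n) 0.
have dhC r : dh (C r) = C r by rewrite /dh /= /dehomog /C pevC.
have dhX : map_mx dh X = v.
  by apply/matrixP => i j; rewrite !mxE /dh /= /dehomog pevX.
have dhG B : map_mx dh (map_mx C B) = map_mx C B :> 'M[A]_n.
  by apply/matrixP => i j; rewrite !mxE dhC.
have dhF y : map_mx dh (F phiC y) = F phiC (map_mx dh y).
  by apply: map_forms_eval => r; apply: dhC.
have [] := @proportional_forms S n d D 0 Fi Hi ai hF hH ha aF L.
  move=> i; rewrite -/(dh (Hi i)) -/(dh (Fi i)).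
  have -> : dh (Hi i) = (map_mx dh (G *m F phiC (M *m X))) i 0 by rewrite mxE.
  have -> : dh (Fi i) = (map_mx dh (F phiC X)) i 0 by rewrite mxE.
  by rewrite map_mxM !dhF map_mxM dhX !dhG HL mxE.
move=> k Hk; exists k => T h x.
pose e : {rmorphism A -> T} := pev h (fun i => x i 0).
have eC r : e (C r) = h r by rewrite /e /C /= pevC.
have eX : map_mx e X = x by apply/matrixP => i j; rewrite !mxE /e /= pevX ord1.
have eG B : map_mx e (map_mx C B) = map_mx h B :> 'M[T]_n.
  by apply/matrixP => i j; rewrite !mxE eC.
have eF y : map_mx e (F phiC y) = F (h \o phi : {rmorphism R -> T}) (map_mx e y).
  by apply: map_forms_eval => r; apply: eC.
have vecE : G *m F phiC (M *m X) = C k *: F phiC X.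
  by apply/matrixP => i j; rewrite ord1 [RHS]mxE; apply: Hk.
move: (congr1 (map_mx e) vecE).
by rewrite map_mxM eF map_mxM map_mxZ eF !eG eX eC.
Qed.

Lemma functor_aut_coords (S : comPzRingType) (phi : {rmorphism R -> S}) p :
  pgl_coords p -> Aut_functor f phi (coord_line p) -> aut_coords phi p.
Proof.
have [S1|nzS] := eqVneq (1 : S) 0.
  move=> pc _; split=> // T h b c x.
  apply/matrixP => i j; apply: zero_ring_eq.
  by rewrite -(rmorph1 h) S1 rmorph0.
move: S nzS phi p; apply: comNzRing_ind => S phi p pc autP; split=> // T h b c x.
have [k Hk] := functor_generic b c pc autP.
have {}Hk y : coord_mx (fun b c => h (p b c)) c *m
   F (h \o phi : {rmorphism R -> T}) (coord_mx (coord_tr (fun b c => h (p b c))) b *m y) =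
   h k *: F (h \o phi : {rmorphism R -> T}) y.
  by have := Hk T h y; rewrite !map_coord_mx.
by rewrite (factor_unique Hk) Hk.
Qed.

End Equivariance.

(** * Integrality of the coordinates *)

Section Integrality.

Variables (R : comPzRingType) (N d D : nat) (f : 'I_N.+1 -> hform R N.+1 d).
Variable a : 'I_N.+1 -> 'I_N.+1 -> hform R N.+1 D.
Local Notation n := N.+1.
Hypothesis cert : forall (T : comPzRingType) (phi : {rmorphism R -> T})
  (x : 'cV[T]_n) (k : 'I_n),
  x k 0 ^+ (D + d) = \sum_i hform_eval phi (a k i) x * hform_eval phi (f i) x.

Local Notation coords T := ('I_n * 'I_n -> 'I_n * 'I_n -> T).
Local Notation F := (forms_eval f).

Lemma map_factor (S T : comPzRingType) (phi : {rmorphism R -> S})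
    (psi : {rmorphism R -> T}) (h : {rmorphism S -> T}) g m :
  (forall r, h (phi r) = psi r) ->
  h (factor f a phi g m) = factor f a psi (map_mx h g) (map_mx h m).
Proof.
move=> e; rewrite /factor rmorph_sum; apply: eq_bigr => t _; rewrite rmorphM.
have he0 : map_mx h (delta_mx 0 0 : 'cV[S]_n) = delta_mx 0 0.
  by apply/matrixP => i j; rewrite !mxE rmorph_nat.
rewrite (rmorph_hform_eval _ _ e) he0; congr (_ * _).
by rewrite -he0 -map_mxM -(map_forms_eval _ _ e) -map_mxM [RHS]mxE.
Qed.

(** The right-hand side of the integral equation, written in p alone: the first factor is a_is(g
    e_j) a_kt(h e_l), of degree D, and the second is (g f(e_j))_s (h f(e_l))_t, of degree 1. *)
Definition reduction (T : comPzRingType) (phi : {rmorphism R -> T}) (p : coords T)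
    (b c : 'I_n * 'I_n) : T :=
  \sum_s \sum_t
    (\sum_(m : monomial n D) \sum_(m' : monomial n D)
        phi (a b.1 s m) * phi (a c.1 t m') *
        \prod_(z <- zip (m2s (val m : 'X_{1..n})) (m2s (val m' : 'X_{1..n})))
          p (z.1, b.2) (z.2, c.2)) *
    \sum_u \sum_w
      hform_eval phi (f u) (delta_mx b.2 0) * hform_eval phi (f w) (delta_mx c.2 0) *
        p (s, u) (t, w).

Lemma rmorph_reduction (S T : comPzRingType) (phi : {rmorphism R -> S})
    (psi : {rmorphism R -> T}) (h : {rmorphism S -> T}) p b c :
  (forall r, h (phi r) = psi r) ->
  h (reduction phi p b c) = reduction psi (fun b c => h (p b c)) b c.
Proof.
move=> e; have he0 j : map_mx h (delta_mx j 0 : 'cV[S]_n) = delta_mx j 0.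
  by apply/matrixP => i z; rewrite !mxE rmorph_nat.
rewrite rmorph_sum; apply: eq_bigr => s _; rewrite rmorph_sum; apply: eq_bigr => t _.
rewrite rmorphM; congr (_ * _); rewrite rmorph_sum; apply: eq_bigr => m _;
  rewrite rmorph_sum; apply: eq_bigr => m' _; rewrite !rmorphM.
  by rewrite !e rmorph_prod.
by rewrite !(rmorph_hform_eval _ _ e) !he0.
Qed.

(** Each term of [reduction] has D + 1 factors p, and each of them absorbs one [coord_den p q] to
    split into an entry of [g] times an entry of [m]. *)
Lemma local_reduction (T : comPzRingType) (phi : {rmorphism R -> T}) (p : coords T)
    (i j k l q : 'I_n) : pgl_coords p ->
  let g := coord_mx p (q, 0) in let m := coord_mx (coord_tr p) (0, q) in
  coord_den p q ^+ D.+1 * reduction phi p (i, j) (k, l) =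
  \sum_s \sum_t hform_eval phi (a i s) (g *m delta_mx j 0) *
     hform_eval phi (a k t) (m *m delta_mx l 0) *
     ((g *m F phi (delta_mx j 0)) s 0 * (m *m F phi (delta_mx l 0)) t 0).
Proof.
move=> pc g m; set s := coord_den p q.
have gE x y : g x y = p (x, y) (q, 0) by rewrite mxE.
have mE x y : m x y = p (0, q) (x, y) by rewrite mxE.
have pE x y z w : s * p (x, y) (z, w) = g x y * m z w by rewrite coord_denM // gE mE.
have colE (A : 'M[T]_n) y x : (A *m delta_mx y 0 : 'cV[T]_n) x 0 = A x y.
  by rewrite -colE mxE.
rewrite /reduction mulr_sumr; apply: eq_bigr => x _; rewrite mulr_sumr; apply: eq_bigr => y _.
rewrite exprSr mulrACA; congr (_ * _).
  rewrite mulr_sumr /hform_eval big_distrlr /=; apply: eq_bigr => u _.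
  rewrite mulr_sumr; apply: eq_bigr => u' _.
  rewrite mulrCA [RHS]mulrACA; congr (_ * _).
  under [X in _ = X * _]eq_bigr do rewrite colE.
  under [X in _ = _ * X]eq_bigr do rewrite colE.
  have szu v : size (m2s (bmnm (val (v : monomial n D)))) = D.
    by rewrite size_m2s mdeg_monomial.
  rewrite -!prod_m2s -prod_zip; last by rewrite !szu.
  rewrite -[in s ^+ D](szu u); move: (szu u) (szu u').
  set r := m2s _; set r' := m2s _ => <- /esym.
  move: r r'; apply: seq_ind2 => [|v v' r r' _ IH]; first by rewrite !big_nil mulr1.
  by rewrite /= !big_cons -pE exprS mulrACA IH.
rewrite !mxE big_distrlr /= mulr_sumr; apply: eq_bigr => u _.
rewrite mulr_sumr; apply: eq_bigr => w _.
by rewrite mulrCA pE !mxE; ring.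
Qed.

(* The two factors of equivariance under g and under g^-1 cancel, which bounds   *)
(* the degree in p.                                                              *)
Lemma integral_equation (T : comPzRingType) (phi : {rmorphism R -> T}) p b c :
  pgl_coords p -> equiv_at f a phi p -> p b c ^+ (D + d) = reduction phi p b c.
Proof.
case: b c => [i j] [k l] pc ep; apply: (local_eq (coord_den_sum pc)) => q.
(* On the right, [D.+1] is spent by [local_reduction]. On the left, D + d splits the coordinates,
   and the remaining d + 3 is [d.+2] for [local_equiv_g] plus 1 for [local_equiv_m]. *)
exists (d.+1 + d.+1 + D.+1)%N; rewrite exprD -mulrA [in RHS]exprD -mulrA.
rewrite (local_reduction phi i j k l q pc) /=.
set g := coord_mx p (q, 0); set m := coord_mx _ (0, q); set s := coord_den p q.
have colE (A : 'M[T]_n) y x : (A *m delta_mx y 0 : 'cV[T]_n) x 0 = A x y.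
  by rewrite -colE mxE.
have pE : s ^+ (D + d) * p (i, j) (k, l) ^+ (D + d) = g i j ^+ (D + d) * m k l ^+ (D + d).
  by rewrite -!exprMn coord_denM // !mxE.
transitivity (s ^+ d.+3 * (g i j ^+ (D + d) * m k l ^+ (D + d))).
  rewrite -pE !mulrA -!exprD; congr (_ ^+ _ * _).
  by rewrite !addSn !addnS addSn -addnA [(d + D)%N]addnC.
rewrite -(colE g) -(colE m) !(cert phi) big_distrlr /= [LHS]mulr_sumr [RHS]mulr_sumr.
apply: eq_bigr => x _; rewrite [LHS]mulr_sumr [RHS]mulr_sumr; apply: eq_bigr => y _.
have Eg : s ^+ d.+2 * hform_eval phi (f x) (g *m delta_mx j 0) =
    s ^+ d.+1 * factor f a phi m g * (g *m F phi (delta_mx j 0)) x 0.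
  have /matrixP/(_ x 0) := local_equiv_g cert pc ep q (delta_mx j 0).
  by rewrite mxE [F _ _ x 0]mxE [RHS]mxE.
have Em : s * hform_eval phi (f y) (m *m delta_mx l 0) =
    factor f a phi g m * (m *m F phi (delta_mx l 0)) y 0.
  have /matrixP/(_ y 0) := local_equiv_m pc ep q (delta_mx l 0).
  by rewrite mxE [F _ _ y 0]mxE [RHS]mxE.
set a1 := hform_eval phi (a i x) _; set a2 := hform_eval phi (a k y) _.
have fV : factor f a phi g m * factor f a phi m g = s ^+ d.+1 := factorV cert pc ep q.
set F1 := hform_eval phi (f x) _ in Eg *; set F2 := hform_eval phi (f y) _ in Em *.
transitivity (a1 * a2 * ((s ^+ d.+2 * F1) * (s * F2))).
  by rewrite [s ^+ d.+3]exprSr; move: (s ^+ d.+2) => s2; ring.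
rewrite Eg Em -!fV.
move: (factor f a phi g m) (factor f a phi m g) => la ka; ring.
Qed.

End Integrality.

(** * The coordinate ring of the automorphism scheme *)

Section CoordinateRing.

Variables (R : comNzRingType) (N d D : nat) (f : 'I_N.+1 -> hform R N.+1 d).
Variable a : 'I_N.+1 -> 'I_N.+1 -> hform R N.+1 D.
Local Notation n := N.+1.
Hypothesis cert : forall (T : comPzRingType) (phi : {rmorphism R -> T})
  (x : 'cV[T]_n) (k : 'I_n),
  x k 0 ^+ (D + d) = \sum_i hform_eval phi (a k i) x * hform_eval phi (f i) x.

Local Notation coords T := ('I_n * 'I_n -> 'I_n * 'I_n -> T).
Local Notation idx := (('I_n * 'I_n) * ('I_n * 'I_n))%type.
Local Notation K := #|{: idx}|.
Local Notation A := {mpoly R[K]}.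
Local Notation F := (forms_eval f).

Definition coord_var : coords A := fun b c => 'X_(enum_rank (b, c)).

Definition coord_ev (T : comPzRingType) (phi : {rmorphism R -> T}) (p : coords T) : A -> T :=
  pev phi (fun k => p (enum_val k).1 (enum_val k).2).

HB.instance Definition _ T phi p := GRing.RMorphism.on (@coord_ev T phi p).

Lemma coord_evX T phi p b c : @coord_ev T phi p (coord_var b c) = p b c.
Proof. by rewrite /coord_ev pevX enum_rankK. Qed.

Lemma coord_evC T phi p r : @coord_ev T phi p r%:MP = phi r.
Proof. exact: pevC. Qed.

Lemma coord_ev_ext (T : comPzRingType) (h h' : {rmorphism A -> T}) :
  (forall r, h r%:MP = h' r%:MP) ->
  (forall b c, h (coord_var b c) = h' (coord_var b c)) -> h =1 h'.
Proof.
move=> eC eX; apply: pev_ext => // k.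
by move: (eX (enum_val k).1 (enum_val k).2); rewrite /coord_var -surjective_pairing enum_valK.
Qed.

Lemma rmorph_coord_ev (S T : comPzRingType) (phi : {rmorphism R -> S})
    (psi : {rmorphism R -> T}) (h : {rmorphism S -> T}) p c :
  (forall r, h (phi r) = psi r) ->
  h (coord_ev phi p c) = coord_ev psi (fun b c => h (p b c)) c.
Proof.
move=> e; apply: (coord_ev_ext (h := h \o coord_ev phi p)
  (h' := coord_ev psi (fun b c => h (p b c)))) => [r|b c'] /=.
  by rewrite !coord_evC.
by rewrite !coord_evX.
Qed.

(** With all functions vanishing on automorphism tensors in the ideal, evaluation at such a tensor
    factors through the quotient at once. What remains is that the universal tensor satisfies the
    equations. *)
Definition aut_ideal (c : A) : Prop :=
  forall (T : comPzRingType) (phi : {rmorphism R -> T}) (p : coords T),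
    aut_coords f a phi p -> coord_ev phi p c = 0.

Lemma aut_idealP : is_ideal aut_ideal.
Proof.
split=> [T phi p _|x y z Iy Iz T phi p pP]; first exact: rmorph0.
by rewrite rmorphD /= /GRing.scale /= rmorphM /= (Iy T) // (Iz T) // mulr0 addr0.
Qed.

Definition aut_ring : comPzRingType := iquot aut_idealP.
Local Notation B := aut_ring.
Local Notation pi := (ipi aut_idealP).

Definition aut_struct : {rmorphism R -> B} := pi \o @mpolyC K R.

Definition univ_coords : coords B := fun b c => pi (coord_var b c).

Section GenericPoint.

Variables b c : 'I_n * 'I_n.

Let A' := {mpoly A[n]}.
Let CA : {rmorphism A -> A'} := @mpolyC n A.
Let psi : {rmorphism R -> A'} := CA \o @mpolyC K R.
Let G := map_mx CA (coord_mx coord_var c).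
Let M := map_mx CA (coord_mx (coord_tr coord_var) b).
Let X : 'cV[A']_n := \col_i 'X_i.

Definition equiv_defect : 'cV[A']_n :=
  G *m F psi (M *m X) - factor f a psi G M *: F psi X.

Lemma map_equiv_defect (T : comPzRingType) (phi : {rmorphism R -> T}) (p : coords T)
    (h : {rmorphism A' -> T}) (x : 'cV[T]_n) :
  (forall r, h (psi r) = phi r) -> (forall b c, h (CA (coord_var b c)) = p b c) ->
  (forall i, h 'X_i = x i 0) ->
  map_mx h equiv_defect =
  coord_mx p c *m F phi (coord_mx (coord_tr p) b *m x) -
  factor f a phi (coord_mx p c) (coord_mx (coord_tr p) b) *: F phi x.
Proof.
move=> hpsi hvar hX.
have hM (q : coords A) (q' : coords T) e : (forall b c, h (CA (q b c)) = q' b c) ->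
    map_mx h (map_mx CA (coord_mx q e)) = coord_mx q' e.
  by move=> hq; apply/matrixP => i j; rewrite !mxE.
have hXE : map_mx h X = x by apply/matrixP => i j; rewrite !mxE hX ord1.
rewrite /equiv_defect map_mxB map_mxM (map_forms_eval _ _ hpsi) map_mxM map_mxZ.
rewrite (map_forms_eval _ _ hpsi) (map_factor _ _ _ _ hpsi) hXE.
rewrite /G /M (hM coord_var p) // (hM (coord_tr coord_var) (coord_tr p)) // => b' c'.
exact: hvar.
Qed.

(** At an automorphism tensor over T, the defect becomes the one at the generic vector over T[x]; it
    vanishes by equivariance after the base change from T to T[x], so all its coefficients do. *)
Lemma equiv_defect_coef i m : aut_ideal (equiv_defect i 0)@_m.
Proof.
move=> T; have [T1|nzT] := eqVneq (1 : T) 0; first by move=> phi p _; apply: zero_ring_eq.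
move: T nzT; apply: comNzRing_ind => T phi p [pc ep].
pose CT : {rmorphism T -> {mpoly T[n]}} := @mpolyC n T.
pose h : {rmorphism A' -> {mpoly T[n]}} :=
  pev (CT \o coord_ev phi p) (fun i => 'X_i).
have hCA y : h (CA y) = CT (coord_ev phi p y) by rewrite /h /CA /= pevC.
transitivity ((h (equiv_defect i 0))@_m).
  by rewrite (mcoeff_pev (g := coord_ev phi p)).
have -> : h (equiv_defect i 0) = (map_mx h equiv_defect) i 0 by rewrite [RHS]mxE.
rewrite (@map_equiv_defect _ (CT \o phi : {rmorphism R -> {mpoly T[n]}})
  (fun b c => CT (p b c)) h (\col_i 'X_i)).
- by rewrite ep subrr mxE mcoeff0.
- by move=> r; rewrite /psi /= hCA coord_evC.
- by move=> b' c'; rewrite hCA coord_evX.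
- by move=> k; rewrite mxE /h /= pevX.
Qed.

End GenericPoint.

Lemma univ_coordsP : aut_coords f a aut_struct univ_coords.
Proof.
split.
  split=> [b c b' c'|i l|k j]; rewrite /univ_coords.
  - rewrite -!rmorphM; apply/ipi_eq => T phi p [pc _].
    by rewrite rmorphB !rmorphM /= !coord_evX (pgl_rank1 pc) subrr.
  - rewrite -rmorph_sum -(rmorph_nat pi); apply/ipi_eq => T phi p [pc _].
    rewrite rmorphB rmorph_sum rmorph_nat /=.
    by under eq_bigr do rewrite coord_evX; rewrite (pgl_invR pc) subrr.
  rewrite -rmorph_sum -(rmorph_nat pi); apply/ipi_eq => T phi p [pc _].
  rewrite rmorphB rmorph_sum rmorph_nat /=.
  by under eq_bigr do rewrite coord_evX; rewrite (pgl_invL pc) subrr.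
move=> T h b c x.
pose hp : {rmorphism A -> T} := h \o pi.
pose e : {rmorphism {mpoly A[n]} -> T} := pev hp (fun i => x i 0).
apply/eqP; rewrite -subr_eq0; apply/eqP.
rewrite -(@map_equiv_defect b c _ (h \o aut_struct) (fun b c => h (univ_coords b c)) e x).
- apply/matrixP => i j; rewrite ord1 mxE [RHS]mxE /e /= /pev big1 // => m _.
  rewrite /hp /= (_ : pi _ = 0) ?rmorph0 ?mul0r //.
  exact/ipi_eq0/equiv_defect_coef.
- by move=> r; rewrite /e /= pevC.
- by move=> b' c'; rewrite /e /= pevC.
- by move=> i; rewrite /e /= pevX.
Qed.

Lemma aut_ring_point (S : comPzRingType) (phi : {rmorphism R -> S}) (p : coords S) :
  (forall c, aut_ideal c -> coord_ev phi p c = 0) ->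
  image_points aut_struct (coord_line univ_coords) phi (coord_line p).
Proof.
move=> pI; pose h : {rmorphism B -> S} := iquot_lift pI.
have hE c : h (pi c) = coord_ev phi p c by exact: iquot_liftE.
exists h; split=> [r|]; first by rewrite [LHS]hE coord_evC.
rewrite pgl_base_line (_ : (fun b c => _) = p) //.
do 2![apply: functional_extensionality => ?].
by rewrite [LHS]hE coord_evX.
Qed.

Lemma image_aut_coords (S : comPzRingType) (phi : {rmorphism R -> S}) alpha :
  image_points aut_struct (coord_line univ_coords) phi alpha <->
  exists2 p, aut_coords f a phi p & alpha = coord_line p.
Proof.
split=> [[h [hs /same_setE ->]]|[p pP ->]].
  rewrite pgl_base_line; exists (fun b c => h (univ_coords b c)) => //.
  exact: aut_coords_map hs univ_coordsP.
by apply: aut_ring_point => c; apply.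
Qed.

Lemma aut_scheme_mono (S : comPzRingType) (h h' : {rmorphism B -> S}) :
  (forall x, h (aut_struct x) = h' (aut_struct x)) ->
  same_set (pgl_base h (coord_line univ_coords))
    (pgl_base h' (coord_line univ_coords)) -> h =1 h'.
Proof.
move=> hs /same_setE; rewrite !pgl_base_line => hu.
have [uc _] := univ_coordsP.
have {}hu := coord_line_inj (pgl_coords_map h uc) (pgl_coords_map h' uc) hu.
move=> u; rewrite -(ipiK u).
apply: (coord_ev_ext (h := h \o pi) (h' := h' \o pi)) => [r|b c] /=; first exact: hs.
exact: (congr1 (fun q : coords S => q b c) hu).
Qed.

Lemma aut_scheme_closed (S : comPzRingType) (phi : {rmorphism R -> S})
    (alpha : 'M[S]_n -> Prop) : pgl_point alpha ->
  exists2 J : S -> Prop, is_ideal J &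
    forall (T : comPzRingType) (h : {rmorphism S -> T}),
      image_points aut_struct (coord_line univ_coords)
        (h \o phi : {rmorphism R -> T}) (pgl_base h alpha)
      <-> forall x, J x -> h x = 0.
Proof.
case/pgl_point_coords => p pc ->.
(* The ideal is the intersection of the kernels of all [h] that kill the values at [p] of
   [aut_ideal]. *)
exists (fun x => forall (T : comPzRingType) (h : {rmorphism S -> T}),
    (forall c, aut_ideal c -> h (coord_ev phi p c) = 0) -> h x = 0).
  split=> [T h _|x y z Jy Jz T h hI]; first exact: rmorph0.
  by rewrite rmorphD /GRing.scale /= rmorphM (Jy T h) // (Jz T h) // mulr0 addr0.
move=> T h; have evE c : h (coord_ev phi p c) =
    coord_ev (h \o phi : {rmorphism R -> T}) (fun b c => h (p b c)) c.
  exact: rmorph_coord_ev.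
rewrite pgl_base_line; split=> [/image_aut_coords[q qP hpq] x Jx|hJ].
  apply: Jx => c Ic; rewrite evE.
  rewrite (coord_line_inj (pgl_coords_map h pc) (proj1 qP) hpq).
  exact: Ic.
by apply: aut_ring_point => c Ic; rewrite -evE; apply: hJ => T' h'; apply.
Qed.

Definition aut_scheme : closed_subscheme_PGL R n :=
  @ClosedSubschemePGL R n B aut_struct (coord_line univ_coords)
    (coord_line_pgl_point (proj1 univ_coordsP)) aut_scheme_mono aut_scheme_closed.

Lemma aut_scheme_subgroup : subgroup_scheme aut_scheme.
Proof.
move=> S phi; split.
- apply/image_aut_coords; exists (@coord_one S n); last by rewrite coord_line_one.
  exact: aut_coords_one.
- move=> _ _ /image_aut_coords[p pP ->] /image_aut_coords[q qP ->].
  apply/image_aut_coords; exists (coord_mul p q); first exact: aut_coords_mul.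
  by rewrite coord_line_mul //; [case: pP | case: qP].
move=> _ /image_aut_coords[p pP ->]; apply/image_aut_coords; exists (coord_tr p).
  exact: aut_coords_tr.
by rewrite pgl_inv_line //; case: pP.
Qed.

Lemma aut_scheme_represents : represents aut_scheme (Aut_functor f).
Proof.
move=> S phi alpha; split=> [/image_aut_coords[p pP ->]|autP].
  exact: aut_coords_functor.
apply/image_aut_coords; have [/pgl_point_coords[p pc eL] _] := autP.
by exists p => //; apply: functor_aut_coords; rewrite // -eL.
Qed.

(** * Finiteness of the coordinate ring *)

Section Finite.

Hypothesis d2 : (2 <= d)%N.
Local Notation e := (D + d)%N.

Let redu (k : 'I_K) : A :=
  reduction f a (@mpolyC K R : {rmorphism R -> A}) coord_var (enum_val k).1 (enum_val k).2.

Lemma reduction_homog b c :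
  reduction f a (@mpolyC K R : {rmorphism R -> A}) coord_var b c \is (D + 1).-homog.
Proof.
have hC0 j x : (delta_mx j 0 : 'cV[A]_n) x 0 \is 0.-homog.
  by rewrite mxE; case: (_ && _); [exact: dhomog1 | exact: dhomog0].
have hf u j : hform_eval (@mpolyC K R : {rmorphism R -> A}) (f u) (delta_mx j 0) \is 0.-homog.
  apply: rpred_sum => m _; apply: (@dhomogM _ _ _ 0%N _ 0%N); first exact: mpolyC_homog.
  elim/big_rec: _ => [|i q _ hq]; first exact: dhomog1.
  apply: (@dhomogM _ _ _ 0%N _ 0%N) => //.
  by have := dhomogMn ((val m : 'X_{1..n}) i) (hC0 j i); rewrite mul0n.
have hv b' c' : coord_var b' c' \is 1.-homog by rewrite dhomogX /= mdeg1.
apply: rpred_sum => s _; apply: rpred_sum => t _; apply: dhomogM.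
  apply: rpred_sum => m _; apply: rpred_sum => m' _.
  apply: (@dhomogM _ _ _ 0%N _ D).
    by apply: (@dhomogM _ _ _ 0%N _ 0%N); apply: mpolyC_homog.
  have szz : size (zip (m2s (val m : 'X_{1..n})) (m2s (val m' : 'X_{1..n}))) = D.
    by rewrite size_zip !size_m2s !mdeg_monomial minnn.
  have hz r : \prod_(z <- r) coord_var (z.1, b.2) (z.2, c.2) \is (size r).-homog.
    elim: r => [|z r IH]; first by rewrite big_nil dhomog1.
    by rewrite big_cons; apply: (@dhomogM _ _ _ 1%N).
  by have := hz (zip (m2s (val m : 'X_{1..n})) (m2s (val m' : 'X_{1..n}))); rewrite szz.
apply: rpred_sum => u _; apply: rpred_sum => w _.
apply: (@dhomogM _ _ _ 0%N _ 1%N) => //.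
by apply: (@dhomogM _ _ _ 0%N _ 0%N).
Qed.

Lemma pi_reduction k : pi 'X_k ^+ e = pi (redu k).
Proof.
have [uc ue] := univ_coordsP.
have Xk : 'X_k = coord_var (enum_val k).1 (enum_val k).2.
  by rewrite /coord_var -surjective_pairing enum_valK.
rewrite {1}Xk -[pi (coord_var _ _)]/(univ_coords _ _).
have ep : equiv_at f a aut_struct univ_coords.
  exact: eq_equiv_at (ue B idfun).
rewrite (integral_equation cert _ _ uc ep) /redu.
by apply/esym/rmorph_reduction.
Qed.

Let Bspan (x : B) : Prop := exists w : {ffun 'I_K -> 'I_e} -> R,
  x = \sum_t aut_struct (w t) * pi 'X_[[multinom (t i : nat) | i < K]].

Let Bspan_sum (J : eqType) (r : seq J) (G : J -> R) (x : J -> B) :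
  (forall j, j \in r -> Bspan (x j)) -> Bspan (\sum_(j <- r) aut_struct (G j) * x j).
Proof.
elim: r => [|j r IH] hr.
  by exists (fun=> 0); rewrite big_nil big1 // => t _; rewrite rmorph0 mul0r.
rewrite big_cons; have [|w ->] := IH; first by move=> i ir; apply: hr; rewrite inE ir orbT.
have [|w' ->] := hr j; first by rewrite mem_head.
exists (fun t => G j * w' t + w t); rewrite mulr_sumr -big_split.
by apply: eq_bigr => t _; rewrite rmorphD rmorphM mulrDl mulrA.
Qed.

Let pi_expand (c : A) : pi c = \sum_(m <- msupp c) aut_struct c@_m * pi 'X_[m].
Proof.
rewrite {1}[c]mpolyE rmorph_sum; apply: eq_bigr => m _.
by rewrite -mul_mpolyC rmorphM.
Qed.

(** Induction on the degree: when some exponent reaches [e], that power is replaced by the form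
    [redu k], and only monomials of smaller degree remain. *)
Let Bspan_monomial m : Bspan (pi 'X_[m]).
Proof.
move: {2}(mdeg m).+1 (ltnSn (mdeg m)) => r; elim: r m => // r IH m mr.
have [/forallP ml|/forallPn[k]] := boolP [forall i, m i < e]%N.
  pose t0 : {ffun 'I_K -> 'I_e} := [ffun i => Ordinal (ml i)].
  exists (fun t => (t == t0)%:R); rewrite (bigD1 t0) //= eqxx rmorph1 mul1r big1 ?addr0.
    by congr (pi 'X_[_]); apply/mnmP => i; rewrite mnmE ffunE.
  by move=> t /negPf->; rewrite rmorph0 mul0r.
rewrite -leqNgt => ek; pose m' := (m - U_(k) *+ e)%MM.
have mE : m = (m' + U_(k) *+ e)%MM.
  rewrite submK //; apply/mnm_lepP => i; rewrite mulmnE mnm1E.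
  by case: eqP => [<-|_]; rewrite ?mul1n.
have -> : pi 'X_[m] = pi ('X_[m'] * redu k).
  by rewrite {1}mE mpolyXD rmorphM -mpolyXn rmorphXn [pi 'X_k ^+ _]pi_reduction -rmorphM.
rewrite pi_expand; apply: Bspan_sum => mu mup; apply: IH.
have hq : 'X_[m'] * redu k \is (mdeg m' + (D + 1)).-homog.
  by apply: dhomogM; [rewrite dhomogX | exact: reduction_homog].
rewrite (dhomog_mf hq mup); apply: (@leq_trans (mdeg m)); last by rewrite -ltnS.
(* The degree drops because D + 1 < D + d; this is where d >= 2 enters. *)
by rewrite mE mdegD mdegMn mdeg1 mul1n !ltn_add2l.
Qed.

Lemma aut_scheme_finite : finite_scheme aut_scheme.
Proof.
exists #|{ffun 'I_K -> 'I_e}|.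
exists (fun k => pi 'X_[[multinom ((enum_val k : {ffun 'I_K -> 'I_e}) i : nat) | i < K]]).
move=> x; suff [w ->] : Bspan x.
  exists (fun k => w (enum_val k)).
  rewrite (reindex (fun k : 'I_#|{ffun 'I_K -> 'I_e}| => enum_val k)) //=.
  by apply: onW_bij; apply: enum_val_bij.
by rewrite -(ipiK x) pi_expand; apply: Bspan_sum => m _; apply: Bspan_monomial.
Qed.

End Finite.

End CoordinateRing.

(** * The zero ring *)

Section ZeroRing.

Variables (R : comPzRingType) (R1 : (1 : R) = 0) (n : nat).

Lemma zero_algebra_eq (S : comPzRingType) (phi : {rmorphism R -> S}) (x y : S) : x = y.
Proof. by apply: zero_ring_eq; rewrite -(rmorph1 phi) R1 rmorph0. Qed.

Lemma zero_algebra_mx (S : comPzRingType) (phi : {rmorphism R -> S}) m k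
  (x y : 'M[S]_(m, k)) : x = y.
Proof. by apply/matrixP => i j; apply: zero_algebra_eq. Qed.

Lemma zero_algebra_full (S : comPzRingType) (phi : {rmorphism R -> S}) m k
  (L : 'M[S]_(m, k) -> Prop) M : submodule L -> L M.
Proof. by move=> sL; rewrite (zero_algebra_mx phi M 0); apply: submod0. Qed.

(** Every algebra over the zero ring is zero, so every matrix module is everything and each point
    set has one element; Spec R itself represents the functor. *)
Let full (M : 'M[R]_n) := True.

Lemma full_pgl_point (S : comPzRingType) (phi : {rmorphism R -> S})
    (alpha : 'M[S]_n -> Prop) : (forall M, alpha M) -> pgl_point alpha.
Proof.
move=> fa; split; first by split.
exists 0%N, (fun=> 0), (fun=> 0), (fun=> 0); split; last by case.
exact: zero_algebra_eq.
Qed.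

Lemma full_image (S : comPzRingType) (phi : {rmorphism R -> S})
    (alpha : 'M[S]_n -> Prop) : (forall M, alpha M) ->
  image_points (idfun : {rmorphism R -> R}) full phi alpha.
Proof.
move=> fa; exists phi; split=> // M; split=> // _.
by apply: (zero_algebra_full phi); apply: modspanP.
Qed.

Lemma zero_scheme_mono (S : comPzRingType) (h h' : {rmorphism R -> S}) :
  (forall x, h ((idfun : {rmorphism R -> R}) x) = h' ((idfun : {rmorphism R -> R}) x)) ->
  same_set (pgl_base h full) (pgl_base h' full) -> h =1 h'.
Proof. by []. Qed.

Lemma zero_scheme_closed (S : comPzRingType) (phi : {rmorphism R -> S})
    (alpha : 'M[S]_n -> Prop) : pgl_point alpha ->
  exists2 J : S -> Prop, is_ideal J &
    forall (T : comPzRingType) (h : {rmorphism S -> T}),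
      image_points (idfun : {rmorphism R -> R}) full (h \o phi : {rmorphism R -> T})
        (pgl_base h alpha) <-> forall x, J x -> h x = 0.
Proof.
move=> _; exists (fun=> True); first by split.
move=> T h; split=> [_ x _|_]; first exact: (zero_algebra_eq (h \o phi)).
apply: full_image => M; apply: (zero_algebra_full (h \o phi)); exact: modspanP.
Qed.

Definition zero_scheme : closed_subscheme_PGL R n :=
  @ClosedSubschemePGL R n R idfun full
    (@full_pgl_point R idfun full (fun=> I)) zero_scheme_mono zero_scheme_closed.

Lemma zero_scheme_aut (d : nat) (f : 'I_n -> hform R n d) :
  [/\ subgroup_scheme zero_scheme, finite_scheme zero_scheme &
      represents zero_scheme (Aut_functor f)].
Proof.
split.
- move=> S phi; split=> [|al be _ _|al _]; apply: full_image => M.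
  + by exists 0; apply: (zero_algebra_mx phi).
  + by apply: (zero_algebra_full phi); apply: modspanP.
  + by move=> g _; exists 0; apply: (zero_algebra_mx phi).
- by exists 0%N, (fun=> 0) => x; exists (fun=> 0); apply: (zero_algebra_eq idfun).
move=> S phi al; split=> [[h [_ e]]|[[sal _] _]]; last first.
  by apply: full_image => M; apply: (zero_algebra_full phi).
split.
  apply: (full_pgl_point phi) => M; apply/e; apply: (zero_algebra_full phi).
  exact: modspanP.
by move=> T h' L _ v; split=> _; apply: (zero_algebra_full (h' \o phi)); apply: modspanP.
Qed.

End ZeroRing.

Theorem mainTheorem6 (R : comPzRingType) (N d : nat)
    (f : 'I_N.+1 -> hform R N.+1 d) :
  noetherian R -> (2 <= d)%N -> is_proj_morphism f ->
  exists Z : closed_subscheme_PGL R N.+1,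
    [/\ subgroup_scheme Z, finite_scheme Z & represents Z (Aut_functor f)].
Proof.
(* The coordinate ring is a quotient of [{mpoly R[_]}], which asks for a nonzero [R]; the zero ring
   is treated apart. *)
have [R1|nzR] := eqVneq (1 : R) 0.
  by move=> _ _ _; exists (zero_scheme R1 N.+1); apply: zero_scheme_aut.
move: R nzR f; apply: comNzRing_ind => R f _ d2 [Res ResP [b fb]].
have [D [a cert]] := resultant_certificate ResP fb.
exists (aut_scheme f a); split.
- exact: aut_scheme_subgroup.
- exact: aut_scheme_finite.
- exact: aut_scheme_represents.
Qed.
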